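(* Let $(\mathcal{A},P,\alpha)$ be a right LCM dynamical system and let $(\phi,T)$ be a contractive covariant representation of it on a Hilbert space $\mathcal{H}$. Then there exists an isometric covariant dilation $(\pi,V)$ of $(\phi,T)$ if and only if $\phi$ is a unital completely positive map. Moreover, (when it exists) the dilation $(\pi,V)$ can be taken to be minimal, and the minimal dilation is unique up to unitary equivalence.
   Context: $P$ is a cancellative semigroup with identity $e$ which is right LCM: for all $p,q\in P$ either $pP\cap qP=\emptyset$ or $pP\cap qP=rP$ for some $r\in P$. $\mathcal{A}$ is a unital $\mathrm{C}^*$-algebra. A $P$-action $\alpha$ assigns to each $p\in P$ a $*$-endomorphism $\alpha_p:\mathcal{A}\to\mathcal{A}$ (not necessarily unital), with $\alpha_p\circ\alpha_q=\alpha_{pq}$ and $\alpha_e=\mathrm{id}$; all $\alpha_p$ are assumed injective. $(\mathcal{A},P,\alpha)$ is a right LCM dynamical system if each $\alpha_p(\mathcal{A})$ is an ideal of $\mathcal{A}$ and, for all $p,q\in P$, $\alpha_p(1)\alpha_q(1)=\alpha_r(1)$ if $pP\cap qP=rP$, and $\alpha_p(1)\alpha_q(1)=0$ if $pP\cap qP=\emptyset$. A contractive (isometric) representation of $P$ is a unital semigroup homomorphism $T:P\to\mathcal{B}(\mathcal{H})$ such that each $T(p)$ is a contraction (an isometry). A contractive covariant representation $(\phi,T)$ on $\mathcal{H}$ consists of a unital $*$-preserving linear map $\phi:\mathcal{A}\to\mathcal{B}(\mathcal{H})$ and a contractive representation $T:P\to\mathcal{B}(\mathcal{H})$ such that $T(p)\phi(a)T(p)^*=\phi(\alpha_p(a))$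 for all $p\in P$, $a\in\mathcal{A}$. An isometric covariant representation $(\pi,V)$ consists of a unital $*$-homomorphism $\pi$ of $\mathcal{A}$ and an isometric representation $V$ of $P$ on the same Hilbert space such that $V(p)\pi(a)V(p)^*=\pi(\alpha_p(a))$ for all $p\in P,a\in\mathcal{A}$. An isometric covariant dilation of $(\phi,T)$ is an isometric covariant representation $(\pi,V)$ on a Hilbert space $\mathcal{K}\supseteq\mathcal{H}$ with $\phi(a)=P_{\mathcal{H}}\pi(a)|_{\mathcal{H}}$ for all $a\in\mathcal{A}$ and $T(p)=P_{\mathcal{H}}V(p)|_{\mathcal{H}}$ for all $p\in P$. It is minimal if $\mathcal{K}=\overline{\operatorname{span}}\{\pi(a)V(p)h: p\in P,\ a\in\mathcal{A}\alpha_p(1),\ h\in\mathcal{H}\}$. Unitary equivalence of two dilations means intertwining by a unitary between the dilation spaces that is the identity on $\mathcal{H}$. *)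

(* Defs.v *)
From HB Require Import structures.
From mathcomp Require Import all_boot all_order all_algebra.
From mathcomp Require Import all_classical all_reals all_analysis.
From mathcomp.real_closed Require Import complex.

Set Implicit Arguments.
Unset Strict Implicit.
Unset Printing Implicit Defensive.

Import Order.TTheory GRing.Theory Num.Theory.
Import numFieldNormedType.Exports.

Local Open Scope classical_set_scope.
Local Open Scope ring_scope.

(* The inner product is linear in its first argument and conjugate linear in
   its second one. *)
HB.mixin Record isHilbert (R : realType) H
    & CompleteNormedModule R[i] H := {
  hdot : {dot H for @Num.conj R[i]} ;
  normr_hdot : forall x : H, `|x| ^+ 2 = hdot x x
}.

#[short(type="hilbertType")]
HB.structure Definition Hilbert (R : realType) :=
  {H of isHilbert R H & CompleteNormedModule R[i] H}.

(* Unital C*-algebras. The product is a separate operation because Hierarchy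
   Builder does not allow a join of the normed module and ring hierarchies
   below numDomainType; this also admits the zero algebra, which algType would
   exclude. *)
HB.mixin Record isCStarAlgebra (R : realType) A
    & CompleteNormedModule R[i] A := {
  cmul : {bilinear A -> A -> A | *:%R & *:%R} ;
  cstar_one : A ;
  star : A -> A ;
  cmulA : associative cmul ;
  cmul1 : left_id cstar_one cmul ;
  cmulr1 : right_id cstar_one cmul ;
  starK : involutive star ;
  starD : {morph star : a b / a + b} ;
  starZ : forall (c : R[i]) (a : A), star (c *: a) = Num.conj c *: star a ;
  starM : forall a b : A, star (cmul a b) = cmul (star b) (star a) ;
  normr_cmul : forall a b : A, `|cmul a b| <= `|a| * `|b| ;
  normr_star : forall a : A, `|cmul (star a) a| = `|a| ^+ 2
}.

#[short(type="cstarType")]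
HB.structure Definition CStarAlgebra (R : realType) :=
  {A of isCStarAlgebra R A & CompleteNormedModule R[i] A}.

Reserved Notation "a ** b" (at level 40, left associativity).
Notation "a ** b" := (cmul a b) : ring_scope.

Section Operators.
Context {R : realType}.
Implicit Types H K : hilbertType R.

Definition bounded_operator H K (f : H -> K) := linear f /\ continuous f.

Definition is_adjoint H K (f : H -> K) (g : K -> H) :=
  forall x y, hdot (f x) y = hdot x (g y).

(* By the Riesz representation theorem every bounded operator f has an adjoint;
   by adj_unique below, adj f is then that adjoint. *)
Definition adj H K (f : H -> K) : K -> H := get (is_adjoint f).

Lemma adj_unique H K (f : H -> K) (g : K -> H) : is_adjoint f g -> adj f = g.
Proof.
move=> fg; have fa : is_adjoint f (adj f) by apply: getPex; exists g.
apply/funext => y; apply/eqP; rewrite -subr_eq0.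
have : hdot (adj f y - g y) (adj f y - g y) = 0.
  by rewrite [LHS]raddfB /= -fa -fg subrr.
by rewrite -normr_hdot => /eqP; rewrite sqrf_eq0 normr_eq0.
Qed.

Definition contraction H K (f : H -> K) :=
  bounded_operator f /\ forall x, `|f x| <= `|x|.

Definition linear_isometry H K (f : H -> K) :=
  linear f /\ forall x, `|f x| = `|x|.

Definition unitary H K (f : H -> K) :=
  linear_isometry f /\ forall y, exists x, f x = y.

Definition linear_span H (S : set H) : set H :=
  [set x | exists n (c : 'I_n -> R[i]) (v : 'I_n -> H),
     (forall i, S (v i)) /\ x = \sum_i c i *: v i].

Definition closed_span H (S : set H) : set H := closure (linear_span S).

End Operators.

Section RightLCM.
Variable P : monoidType.
Implicit Types p q r : P.

Definition principal_right_ideal p : set P := range (fun x => p * x)%g.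

Definition cancellative :=
  left_injective (fun p q => p * q)%g /\ right_injective (fun p q => p * q)%g.

Definition right_LCM := forall p q,
  principal_right_ideal p `&` principal_right_ideal q = set0 \/
  exists r, principal_right_ideal p `&` principal_right_ideal q
            = principal_right_ideal r.

End RightLCM.

Section Systems.
Context {R : realType}.
Variables (P : monoidType) (A : cstarType R).
Implicit Types (p q r : P) (a b : A) (alpha : P -> A -> A).

(* Not required to be unital. *)
Record star_endomorphism (f : A -> A) : Prop := {
  star_endo_linear : linear f ;
  star_endo_mul : forall a b, f (a ** b) = f a ** f b ;
  star_endo_star : forall a, f (star a) = star (f a)
}.

Record semigroup_action alpha : Prop := {
  action_endo : forall p, star_endomorphism (alpha p) ;
  action_comp : forall p q, alpha p \o alpha q = alpha (p * q)%g ;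
  action_id : alpha 1%g = id ;
  action_inj : forall p, injective (alpha p)
}.

(* Two-sided; the ranges of injective *-endomorphisms, to which this is
   applied, are automatically norm closed. *)
Record ideal (I : set A) : Prop := {
  ideal0 : I 0 ;
  ideal_linear : forall (c : R[i]) a b, I a -> I b -> I (c *: a + b) ;
  ideal_mull : forall a b, I b -> I (a ** b) ;
  ideal_mulr : forall a b, I a -> I (a ** b)
}.

Record right_LCM_system alpha : Prop := {
  system_cancellative : cancellative P ;
  system_right_LCM : right_LCM P ;
  system_action : semigroup_action alpha ;
  system_ideal : forall p, ideal (range (alpha p)) ;
  system_lcm : forall p q r,
    principal_right_ideal p `&` principal_right_ideal q
      = principal_right_ideal r ->
    alpha p cstar_one ** alpha q cstar_one = alpha r cstar_one ;
  system_disjoint : forall p q,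
    principal_right_ideal p `&` principal_right_ideal q = set0 ->
    alpha p cstar_one ** alpha q cstar_one = 0
}.

End Systems.

Section Representations.
Context {R : realType}.
Variables (P : monoidType) (A : cstarType R) (alpha : P -> A -> A).
Implicit Types (H K : hilbertType R) (p q : P) (a b : A).

Record semigroup_rep H (T : P -> H -> H) : Prop := {
  rep_one : T 1%g = id ;
  rep_mul : forall p q, T (p * q)%g = T p \o T q
}.

Definition contractive_rep H (T : P -> H -> H) :=
  semigroup_rep T /\ forall p, contraction (T p).

Definition isometric_rep H (V : P -> H -> H) :=
  semigroup_rep V /\ forall p, linear_isometry (V p).

Record linear_operator_map H (phi : A -> H -> H) : Prop := {
  operator_map_bounded : forall a, bounded_operator (phi a) ;
  operator_map_linear : forall (c : R[i]) a b x,
    phi (c *: a + b) x = c *: phi a x + phi b x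
}.

Record unital_selfadjoint_map H (phi : A -> H -> H) : Prop := {
  selfadjoint_map_linear : linear_operator_map phi ;
  selfadjoint_map_one : phi cstar_one = id ;
  selfadjoint_map_star : forall a, phi (star a) = adj (phi a)
}.

Definition unital_star_hom H (pi : A -> H -> H) :=
  unital_selfadjoint_map pi /\ forall a b, pi (a ** b) = pi a \o pi b.

Definition covariant H (phi : A -> H -> H) (T : P -> H -> H) :=
  forall p a, T p \o phi a \o adj (T p) = phi (alpha p a).

Record contractive_covariant_rep H (phi : A -> H -> H) (T : P -> H -> H) :
    Prop := {
  contractive_covariant_map : unital_selfadjoint_map phi ;
  contractive_covariant_contractive : contractive_rep T ;
  contractive_covariant_covariant : covariant phi T
}.

Record isometric_covariant_rep H (pi : A -> H -> H) (V : P -> H -> H) :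
    Prop := {
  isometric_covariant_hom : unital_star_hom pi ;
  isometric_covariant_isometric : isometric_rep V ;
  isometric_covariant_covariant : covariant pi V
}.

(* X = Y^* Y in M_n(A), entrywise. *)
Definition positive_matrix n (X : 'M[A]_n) :=
  exists Y : 'M[A]_n, forall i j, X i j = \sum_k star (Y k i) ** Y k j.

(* M_n(B(H)) acts on the n-fold direct sum of H: positivity of the operator
   matrix (F i j) means that its quadratic form is nonnegative. The order on
   R[i] makes "0 <= z" say that z is real and nonnegative. *)
Definition positive_operator_matrix H n (F : 'I_n -> 'I_n -> H -> H) :=
  forall h : 'I_n -> H, 0 <= \sum_i \sum_j hdot (F i j (h j)) (h i).

Definition completely_positive H (phi : A -> H -> H) :=
  forall n (X : 'M[A]_n), positive_matrix X ->
    positive_operator_matrix (fun i j => phi (X i j)).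

Record unital_completely_positive H (phi : A -> H -> H) : Prop := {
  ucp_linear : linear_operator_map phi ;
  ucp_one : phi cstar_one = id ;
  ucp_positive : completely_positive phi
}.

(* The inclusion of H in K is an isometric embedding J, so that the compression
   of an operator F on K to H is J^* F J. *)
Record isometric_covariant_dilation H (phi : A -> H -> H) (T : P -> H -> H)
    K (J : H -> K) (pi : A -> K -> K) (V : P -> K -> K) : Prop := {
  dilation_embedding : linear_isometry J ;
  dilation_rep : isometric_covariant_rep pi V ;
  dilation_map : forall a, phi a = adj J \o pi a \o J ;
  dilation_semigroup : forall p, T p = adj J \o V p \o J
}.

(* The elements of A alpha_p(1) are the products b ** alpha p 1. *)
Definition minimal_dilation H K (J : H -> K) (pi : A -> K -> K)
    (V : P -> K -> K) :=
  closed_span [set x | exists p b h,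
    x = pi (b ** alpha p cstar_one) (V p (J h))] = setT.

Definition unitarily_equivalent H
    K1 (J1 : H -> K1) (pi1 : A -> K1 -> K1) (V1 : P -> K1 -> K1)
    K2 (J2 : H -> K2) (pi2 : A -> K2 -> K2) (V2 : P -> K2 -> K2) :=
  exists U : K1 -> K2,
    [/\ unitary U, U \o J1 = J2,
        forall a, U \o pi1 a = pi2 a \o U &
        forall p, U \o V1 p = V2 p \o U].

End Representations.

(* Main.v *)
Require Import Defs.
From HB Require Import structures.
From mathcomp Require Import all_boot all_order all_algebra.
From mathcomp Require Import all_classical all_reals all_analysis.
From mathcomp.real_closed Require Import complex.
From mathcomp Require Import ring.

(** The idea is to guess the Gram matrix of the vectors [pi(a) V(p) h] of a
    dilation, with [p] in [P], [a] in [A] and [h] in [H], and to build the dilation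
    from it. Write [e_p = alpha_p(1)], a central projection since [alpha_p(A)] is an
    ideal, and let [beta_p] be the inverse of [alpha_p] on this ideal.

    In a dilation, [T(p) T(p)^* = phi(e_p)] is the compression of
    [V(p) V(p)^* = pi(e_p)], so that [V(p)^*] loses no norm when it is compressed:
    it maps [H] to itself and extends [T(p)^*] ([dilation_coextension]). If
    [r = p p' = q q'] is a least common multiple, [e_p e_q = e_r], so that only the
    part of [c = b^* a] in [alpha_r(A)] counts, and moving [V(r)] to both sides gives
    [<pi(a) V(p) h, pi(b) V(q) g> = <phi(beta_r(c)) T(p')^* h, T(q')^* g>]. If [p]
    and [q] have no common multiple, [e_p e_q = 0] and the inner product vanishes.
    This is [dilation_gram]. As the right hand side [dilation_form] depends on [phi]
    and [T] only, two minimal dilations have total families with the same Gram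
    matrix, and are unitarily equivalent.

    Conversely, let [phi] be completely positive. The form [dilation_form] has to be
    shown positive semidefinite ([dilation_form_positive]). The projections [e_p] of
    finitely many [p] cut [1] into central projections [E], each of which is below or
    orthogonal to every [e_p]; the [p] with [e_p] above [E] have a common multiple
    [r] with [E] below [e_r]. By covariance of [phi] the least common multiples in
    the form can all be replaced with this single [r] ([dilation_form_multiple]), and
    what remains is the form of a positive matrix of the type [y_j^* y_i].

    The kernel is then the Gram matrix of a total family [v] in a Hilbert space
    ([kernel_realization]), and the operators are prescribed on this family:
    [pi(b) v(p, a, h) = v(p, b a, h)], which is bounded because [m^2 - b^* b] is of the
    form [d^* d] when [m > |b|] ([cstar_sqrt]), and
    [V(q) v(p, a, h) = v(q p, alpha_q(a), h)], which is isometric. Covariance amounts to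
    [V(q) V(q)^* = pi(e_q)], and follows from [v(p, a, h) = v(p t, a, T(t)^* h)] for [a]
    in the ideal of [p t] ([model_shift]).

    Complete positivity is necessary since compressions of representations are
    completely positive. *)

Set Implicit Arguments.
Unset Strict Implicit.
Unset Printing Implicit Defensive.

Import Order.TTheory GRing.Theory Num.Theory.
Import numFieldNormedType.Exports.

Local Open Scope classical_set_scope.
Local Open Scope ring_scope.

(** * Limits of families of approximations *)

Lemma ler_eps_scale (F : numFieldType) (c x y : F) : 0 <= c ->
  (forall e, 0 < e -> x <= y + c * e) -> x <= y.
Proof.
move=> c0 h; apply/ler_addgt0Pr => e e0.
have c1 : 0 < c + 1 by rewrite ltr_wpDl.
apply: le_trans (h _ (divr_gt0 e0 c1)) _; rewrite lerD2l mulrCA ger_pMr//.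
by rewrite ler_pdivrMr// mul1r lerDl.
Qed.

Lemma eq_eps_scale (F : numFieldType) (V : normedZmodType F) (c : F) (x y : V) :
  0 <= c -> (forall e, 0 < e -> `|x - y| <= c * e) -> x = y.
Proof.
move=> c0 h; apply/eqP; rewrite -subr_eq0 -normr_eq0 -[X in X == _]ger0_norm//.
rewrite normr_id; apply/eqP/le_anti; rewrite normr_ge0 andbT.
by apply: (ler_eps_scale c0) => e e0; rewrite add0r h.
Qed.

Lemma ler_dist_chain (F : numFieldType) (V : normedZmodType F) (x y z : V) d e :
  `|x - y| <= d -> `|y - z| <= e -> `|x - z| <= d + e.
Proof.
by move=> xy yz; rewrite -(subrKA y) (le_trans (ler_normD _ _))// lerD.
Qed.

(** [S e v] reads: [v] is an approximation of precision [e]. The limit is that of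
    the filter generated by the sets of approximations of precision at most [e]. *)
Lemma approximations_converge (F : numFieldType) (V : completeNormedModType F)
    (S : F -> V -> Prop) (c : F) : 0 <= c ->
  (forall e, 0 < e -> exists v, S e v) ->
  (forall e e' v v', 0 < e -> 0 < e' -> S e v -> S e' v' ->
     `|v - v'| <= c * (e + e')) ->
  exists l, forall e v, 0 < e -> S e v -> `|l - v| <= c * e.
Proof.
move=> c0 S0 Scauchy.
pose B e : set V := [set w | exists2 d, 0 < d <= e & S d w].
pose G := filter_from [set e : F | 0 < e] B.
have Bne e : 0 < e -> B e !=set0.
  by move=> e0; have [v Sv] := S0 e e0; exists v; exists e; rewrite ?e0 ?lexx.
have GF : ProperFilter G.
  apply: filter_from_proper => //; apply: filter_from_filter.
    by exists 1; rewrite /= ltr01.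
  move=> a b /= a0 b0; exists (Num.min a b).
    by rewrite /= minElt; case: (a < b).
  move=> w [d /andP[d0]]; rewrite comparable_le_min; last first.
    by apply: real_comparable; exact: gtr0_real.
  by move=> /andP[da db] Sd; split; exists d; rewrite ?d0.
have : cvg G.
  apply: cauchy_cvg; apply: cauchy_exP => e e0.
  pose d := e / (2 * (c + 1)).
  have c1 : 0 < c + 1 by rewrite ltr_wpDl.
  have d0 : 0 < d by rewrite divr_gt0// mulr_gt0.
  have [v Sv] := S0 _ d0; exists v; exists d => // w [d' /andP[d'0 d'd] Sw].
  rewrite -ball_normE /=; apply: le_lt_trans (Scauchy _ _ _ _ d0 d'0 Sv Sw) _.
  apply: (@le_lt_trans _ _ (c * (d + d))); first by rewrite ler_wpM2l// lerD2l.
  have -> : c * (d + d) = e * (c / (c + 1)) by rewrite /d; field; rewrite gt_eqF.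
  rewrite gtr_pMr//.
  by rewrite ltr_pdivrMr// mul1r ltrDl.
move=> /cvg_ex[l Gl]; exists l => e v e0 Sv.
apply: (@ler_eps_scale _ (1 + c)) => [|d d0]; first by rewrite addr_ge0.
have : G (ball l d) by apply: Gl; exact: nbhsx_ballx.
move=> [r r0 Br]; have [w [r' /andP[r'0 r'm] Sw]] : B (Num.min r d) !=set0.
  by apply: Bne; rewrite minElt; case: (r < d).
have rd : (r >=< d)%R by apply: real_comparable; exact: gtr0_real.
move: r'm; rewrite comparable_le_min// => /andP[r'r r'd].
have lw : `|l - w| < d.
  have := Br w; rewrite -ball_normE /=; apply.
  by exists r'; rewrite ?r'0.
rewrite -(subrKA w) (le_trans (ler_normD _ _))// [in leRHS]mulrDl mul1r addrCA.
rewrite lerD ?(ltW lw)// (le_trans (Scauchy _ _ _ _ r'0 e0 Sw Sv))//.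
by rewrite -mulrDr ler_wpM2l// addrC lerD2l.
Qed.

Section Complex.
Variable R : realType.
Local Notation C := R[i].

(** The real and the imaginary parts converge separately, hence the factor 2. *)
Lemma complex_approximations_converge (S : C -> C -> Prop) (c : C) : 0 <= c ->
  (forall e, 0 < e -> exists v, S e v) ->
  (forall e e' v v', 0 < e -> 0 < e' -> S e v -> S e' v' ->
     `|v - v'| <= c * (e + e')) ->
  exists l, forall e v, 0 < e -> S e v -> `|l - v| <= 2 * c * e.
Proof.
move=> c0 S0 Scauchy.
have real_gt0 (e : C) : 0 < e -> e = (complex.Re e)%:C%C /\ 0 < complex.Re e.
  by case: e => a b; rewrite ltcE /= => /andP[/eqP -> ->].
have real_ge0 (e : C) : 0 <= e -> e = (complex.Re e)%:C%C /\ 0 <= complex.Re e.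
  by case: e => a b; rewrite lecE /= => /andP[/eqP -> ->].
have part (f : C -> R) : (forall x y, f (x - y) = f x - f y) ->
    (forall x, `|f x|%:C%C <= `|x|) ->
  exists l, forall e v, 0 < e -> S e v -> `|l - f v|%:C%C <= c * e.
  move=> fB fn; have [cE cR0] := real_ge0 c c0.
  have [e e0|e e' _ _ e0 e'0 [v [Sv ->]] [v' [Sv' ->]]|l hl] :=
    @approximations_converge R R (fun e r => exists v, S e%:C%C v /\ r = f v)
      (complex.Re c) cR0.
  - by have [|v Sv] := S0 e%:C%C; [rewrite ltcR|exists (f v), v].
  - rewrite -lecR -fB (le_trans (fn _))//.
    have := Scauchy e%:C%C e'%:C%C v v'; rewrite !ltcR => /(_ e0 e'0 Sv Sv').
    by move=> /le_trans; apply; rewrite {1}cE -rmorphD -rmorphM.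
  - exists l => e v /real_gt0[eE e0] Sv; rewrite cE eE -rmorphM lecR.
    by apply: hl => //; exists v; rewrite -eE.
have [||x hx] := part (@complex.Re R).
- by move=> [? ?] [? ?].
- exact: normc_ge_Re.
have [||y hy] := part (@complex.Im R).
- by move=> [? ?] [? ?].
- move=> z; have := normc_ge_Re (z * 'i%C).
  rewrite ReiNIm normrN normrM (normc_def 'i%C) /= expr0n expr1n add0r.
  by rewrite sqrtr1 mulr1.
exists (x +i* y)%C => e v e0 Sv; rewrite -mulrA mulr_natl mulr2n.
have -> : (x +i* y)%C - v =
    (x - complex.Re v)%:C%C + 'i%C * (y - complex.Im v)%:C%C.
  by case: v {Sv} => a b; rewrite [RHS](_ : _ = Complex (x - a) (y - b)) //; simpc.
rewrite (le_trans (ler_normD _ _))// normrM (normc_def 'i%C) /= expr0n expr1n.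
rewrite add0r sqrtr1 mul1r.
have normR (r : R) : `|r%:C%C| = `|r|%:C%C.
  by rewrite normc_def /= expr0n addr0 sqrtr_sqr.
by rewrite !normR lerD// ?hx ?hy.
Qed.
End Complex.

(** * Inner products *)

(** Being real at (1, 1) and (i, 1) makes the form hermitian. Its sign at (b, - z)
    is the inequality if [b != 0]; if [b = 0], the form at (1, - w z) is
    [a - 2 w |z|^2], and would be negative for large [w] unless [z = 0]. *)
Lemma psd2_hermitian_CauchySchwarz (F : numClosedFieldType) (a b z z' : F) :
  (forall s t, 0 <= s * s^* * a + s * t^* * z + t * s^* * z' + t * t^* * b) ->
  z' = z^* /\ `|z| ^+ 2 <= a * b.
Proof.
move=> h.
have a0 : 0 <= a.
  by have := h 1 0; rewrite !rmorph1 !rmorph0 !(mulr0, mul0r, mulr1, mul1r, addr0).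
have b0 : 0 <= b.
  by have := h 0 1; rewrite !rmorph1 !rmorph0 !(mulr0, mul0r, mulr1, mul1r, add0r).
have [ar br] : a^* = a /\ b^* = b by split; apply/CrealP; exact: ger0_real.
have zz' : z' = z^*.
  have /ger0_real/CrealP : 0 <= a + b + (z + z').
    have := h 1 1; rewrite rmorph1 !mul1r.
    by rewrite [X in 0 <= X](_ : _ = a + b + (z + z')) //; ring.
  have /ger0_real/CrealP : 0 <= a + b + 'i * (z - z').
    have := h 'i 1; rewrite rmorph1 conjCi.
    rewrite [X in 0 <= X](_ : _ = - 'i ^+ 2 * a + b + 'i * (z - z')).
      by rewrite sqrCi opprK mul1r.
    by ring.
  rewrite !(rmorphD, rmorphM, rmorphN) /= conjCi ar br => /addrI e1 /addrI e2.
  have {}e1 : z'^* - z^* = z - z'.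
    by apply: (mulfI (neq0Ci F)); rewrite -e1; ring.
  apply: (@mulfI _ 2); first by rewrite pnatr_eq0.
  have -> : 2 * z' = z + z' - (z - z') by ring.
  by rewrite -e1 -e2; ring.
split => //; rewrite {}zz' in h.
have [b00|b00] := eqVneq b 0; last first.
  have b1 : 0 < b by rewrite lt_def b00.
  have := h b (- z); rewrite rmorphN /= br.
  rewrite [X in 0 <= X](_ : _ = b * (a * b - `|z| ^+ 2)).
    by rewrite pmulr_rge0// subr_ge0.
  by rewrite normCK; ring.
rewrite b00 mulr0; apply: contrapT => /negP nz.
have z0 : 0 < `|z| ^+ 2.
  by rewrite lt_def exprn_ge0 ?normr_ge0// andbT; apply: contra nz => /eqP ->.
pose w := (a + 1) / `|z| ^+ 2.
have wz : w * (z * z^*) = a + 1 by rewrite -normCK divfK ?gt_eqF.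
have wr : w^* = w.
  by apply/CrealP; rewrite ger0_real// divr_ge0 ?exprn_ge0// addr_ge0.
have := h 1 (- (w * z)); rewrite b00 mulr0 addr0 rmorph1 rmorphN rmorphM /= wr.
rewrite [X in 0 <= X](_ : _ = a - 2 * (w * (z * z^*))); last by ring.
rewrite wz [X in 0 <= X](_ : _ = - (a + 2)); last by ring.
by rewrite oppr_ge0 => /le_gtF; rewrite ltr_wpDl.
Qed.

Section Hilbert.
Variable R : realType.
Local Notation C := R[i].
Implicit Types H K : hilbertType R.

Section Dot.
Variable H : hilbertType R.
Implicit Types (x y z : H) (c : C).

Lemma hdotDl x y z : hdot (x + y) z = hdot x z + hdot y z.
Proof. exact: linearDl. Qed.

Lemma hdotDr x y z : hdot z (x + y) = hdot z x + hdot z y.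
Proof. exact: raddfD. Qed.

Lemma hdotBl x y z : hdot (x - y) z = hdot x z - hdot y z.
Proof. exact: linearBl. Qed.

Lemma hdotBr x y z : hdot z (x - y) = hdot z x - hdot z y.
Proof. exact: raddfB. Qed.

Lemma hdotZl c x z : hdot (c *: x) z = c * hdot x z.
Proof. exact: linearZl_LR. Qed.

Lemma hdotZr c x z : hdot z (c *: x) = c^* * hdot z x.
Proof. exact: linearZr_LR. Qed.

Lemma hdot0l x : hdot 0 x = 0. Proof. exact: linear0l. Qed.

Lemma hdot0r x : hdot x 0 = 0. Proof. exact: raddf0. Qed.

Lemma hdot_suml I (r : seq I) (F : I -> H) x :
  hdot (\sum_(i <- r) F i) x = \sum_(i <- r) hdot (F i) x.
Proof. exact: linear_sumlz. Qed.

Lemma hdot_sumr I (r : seq I) (F : I -> H) x :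
  hdot x (\sum_(i <- r) F i) = \sum_(i <- r) hdot x (F i).
Proof. exact: raddf_sum. Qed.

Lemma hdotC x y : hdot y x = (hdot x y)^*.
Proof. by rewrite (hermC hdot) expr0 mul1r. Qed.

Lemma hdot_ge0 x : 0 <= hdot x x.
Proof. by rewrite -normr_hdot exprn_ge0. Qed.

Lemma hdot_CauchySchwarz x y : `|hdot x y| <= `|x| * `|y|.
Proof.
rewrite -(@ler_pXn2r _ 2)// ?nnegrE ?mulr_ge0// exprMn !normr_hdot.
have [//|//] := @psd2_hermitian_CauchySchwarz _
  (hdot x x) (hdot y y) (hdot x y) (hdot y x).
move=> s t; have := hdot_ge0 (s *: x + t *: y).
by rewrite !(hdotDl, hdotDr, hdotZl, hdotZr) !mulrA !addrA.
Qed.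

Lemma hdot_inj x y : (forall z, hdot z x = hdot z y) -> x = y.
Proof.
move=> h; apply/eqP; rewrite -subr_eq0 -normr_eq0 -sqrf_eq0 normr_hdot.
by rewrite hdotBr h subrr.
Qed.
End Dot.

(** * The Riesz representation theorem and adjoints *)

Section Riesz.
Variable H : hilbertType R.

(** If [x] minimizes [|x|^2 - 2 Re f(x)] up to [e^2], then moving it in the
    direction [y] shows [|f(y) - <y, x>| <= e |y|]. Such approximate representatives
    are close to each other, and converge. *)
Lemma Riesz_representation (f : H -> C) (M : C) : 0 <= M -> scalar f ->
  (forall x, `|f x| <= M * `|x|) -> exists w, forall x, f x = hdot x w.
Proof.
move=> M0 flin fM.
have f0 : f 0 = 0.
  by have := flin (-1) 0 0; rewrite scaler0 addr0 mulN1r addNr.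
have fD x y : f (x + y) = f x + f y by have := flin 1 x y; rewrite scale1r mul1r.
have fZ c x : f (c *: x) = c * f x by have := flin c x 0; rewrite !addr0 f0 addr0.
pose g x := hdot x x - (f x + (f x)^*).
have gE x : g x = (complex.Re (g x))%:C%C.
  rewrite RRe_real// rpredB ?(ger0_real (hdot_ge0 _))//.
  by apply/CrealP; rewrite rmorphD /= conjCK addrC.
have g_ge x : - M ^+ 2 <= g x.
  have : f x + (f x)^* <= 2 * (M * `|x|).
    rewrite (le_trans (real_ler_norm _))//.
      by apply/CrealP; rewrite rmorphD /= conjCK addrC.
    by rewrite (le_trans (ler_normD _ _))// norm_conjC mulr_natl mulr2n lerD.
  have : 0 <= (`|x| - M) ^+ 2.
    by apply: real_exprn_even_ge0 => //; rewrite rpredB ?ger0_real.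
  rewrite sqrrB normr_hdot => h1 h2.
  rewrite /g lerBrDr (le_trans (lerD (lexx _) h2))// -subr_ge0.
  by rewrite [X in 0 <= X](_ : _ = hdot x x - `|x| * M *+ 2 + M ^+ 2) //; ring.
pose E := range (fun x => complex.Re (g x)).
have infE : has_inf E.
  split; first by exists (complex.Re (g 0)), 0.
  exists (complex.Re (- M ^+ 2)) => _ [x _ <-].
  by have := g_ge x; rewrite lecE => /andP[].
pose S e w := forall y, `|f y - hdot y w| <= e * `|y|.
have S0 e : 0 < e -> exists w, S e w.
  move=> e0; have [eE Re0] : e = (complex.Re e)%:C%C /\ 0 < complex.Re e.
    by case: e e0 => a b; rewrite ltcE /= => /andP[/eqP -> ->].
  have [_ [x _ <-] xinf] := inf_adherent (exprn_gt0 2 Re0) infE.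
  exists x => y; have [->|y0] := eqVneq y 0.
    by rewrite f0 hdot0l subrr !normr0 mulr0.
  (* The step in the direction [y] that decreases the functional most. *)
  pose t := (f y - hdot y x)^* / hdot y y.
  have yy : hdot y y != 0 by rewrite -normr_hdot sqrf_eq0 normr_eq0.
  have yr : (hdot y y)^* = hdot y y by rewrite -hdotC.
  have : 0 <= e ^+ 2 + g (x + t *: y) - g x.
    rewrite eE (gE x) (gE (_ + _)) -rmorphXn -rmorphD -rmorphB ler0c.
    rewrite subr_ge0 addrC (le_trans (ltW xinf))// lerD2r.
    by apply: ge_inf; [case: infE|exists (x + t *: y)].
  rewrite /g !(hdotDl, hdotDr, hdotZl, hdotZr) fD fZ rmorphD rmorphM /=.
  rewrite [X in 0 <= X](_ : _ = e ^+ 2 - `|f y - hdot y x| ^+ 2 / hdot y y).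
    rewrite subr_ge0 ler_pdivrMr; last by rewrite lt_def yy hdot_ge0.
    rewrite -normr_hdot -exprMn ler_pXn2r// nnegrE// mulr_ge0// ltW//.
  rewrite normCK (hdotC y x) /t !(rmorphM, rmorphB, fmorphV) /= !conjCK yr.
  by field.
have Scauchy e e' v v' : 0 < e -> 0 < e' -> S e v -> S e' v' ->
    `|v - v'| <= 1 * (e + e').
  move=> e0 e'0 hv hv'; rewrite mul1r.
  have [->|vv'] := eqVneq v v'; first by rewrite subrr normr0 addr_ge0// ltW.
  rewrite -(@ler_pM2r _ `|v - v'|) ?normr_gt0 ?subr_eq0//.
  rewrite -expr2 normr_hdot -[leLHS]ger0_norm ?hdot_ge0//.
  set y := v - v' in hv hv' *; rewrite {2}/y hdotBr.
  rewrite -(subrKA (f y)) (le_trans (ler_normD _ _))// mulrDl distrC.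
  by rewrite lerD.
have [l hl] := approximations_converge ler01 S0 Scauchy.
exists l => y; apply: (@eq_eps_scale _ _ (2 * `|y|)).
  by rewrite mulr_ge0.
move=> e e0; have [w Sw] := S0 e e0; have := hl _ _ e0 Sw; rewrite mul1r => lw.
rewrite -(subrKA (hdot y w)) (le_trans (ler_normD _ _))// -mulrA mulr_natl.
rewrite mulr2n lerD//; first by rewrite mulrC.
by rewrite -hdotBr (le_trans (hdot_CauchySchwarz _ _))// distrC ler_wpM2l.
Qed.
End Riesz.

Lemma bounded_operatorP H K (f : H -> K) :
  bounded_operator f <->
  linear f /\ exists2 M, 0 <= M & forall x, `|f x| <= M * `|x|.
Proof.
have lin (flin : linear f) : exists F : {linear H -> K}, F = f :> (H -> K).
  pose FL := GRing.isLinear.Build _ _ _ _ f flin.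
  by exists (HB.pack_for {linear H -> K} f FL).
split=> [[flin]|[flin]]; have [F FE] := lin flin; rewrite -FE => fc; split=> //.
- by rewrite FE.
- move/linear_bounded_continuous/linear_boundedP: fc.
  by move=> /pinfty_ex_gt0[M M0 FM]; exists M; first exact: ltW.
- by rewrite FE.
- apply/linear_bounded_continuous/linear_boundedP; case: fc => M M0 FM.
  near=> r => x; apply: le_trans (FM x) _; apply: ler_wpM2r => //.
  by near: r; apply: nbhs_pinfty_ge; exact: ger0_real.
Unshelve. all: by end_near. Qed.

Lemma bounded_operator_adj H K (f : H -> K) :
  bounded_operator f -> is_adjoint f (adj f).
Proof.
move=> /bounded_operatorP[flin [M M0 fM]].
have rep y : exists w, forall x, hdot (f x) y = hdot x w.
  apply: (@Riesz_representation _ _ (M * `|y|)); first by rewrite mulr_ge0.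
    by move=> c u v; rewrite flin hdotDl hdotZl.
  move=> x; rewrite (le_trans (hdot_CauchySchwarz _ _))// mulrAC.
  by rewrite ler_wpM2r.
have [g hg] := choice rep.
by apply: (@getPex _ (is_adjoint f)); exists g => x y; rewrite hg.
Qed.

Lemma is_adjoint_sym H K (f : H -> K) g : is_adjoint f g -> is_adjoint g f.
Proof. by move=> fg x y; rewrite hdotC -fg -hdotC. Qed.

Lemma is_adjoint_linear H K (f : H -> K) g : is_adjoint f g -> linear g.
Proof.
move=> fg c x y; apply: hdot_inj => z.
by rewrite hdotDr hdotZr -!fg hdotDr hdotZr.
Qed.

Lemma is_adjoint_bound H K (f : H -> K) g M : is_adjoint f g -> 0 <= M ->
  (forall x, `|f x| <= M * `|x|) -> forall y, `|g y| <= M * `|y|.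
Proof.
move=> fg M0 fM y; have [->|gy0] := eqVneq (g y) 0.
  by rewrite normr0 mulr_ge0.
rewrite -(@ler_pM2l _ `|g y|) ?normr_gt0// -expr2 normr_hdot -fg.
rewrite -[leLHS]ger0_norm ?fg ?hdot_ge0// -fg (le_trans (hdot_CauchySchwarz _ _))//.
by rewrite mulrA [_ * M]mulrC ler_wpM2r.
Qed.

Lemma bounded_operator_is_adjoint H K (f : H -> K) g :
  is_adjoint f g -> bounded_operator f -> bounded_operator g.
Proof.
move=> fg /bounded_operatorP[_ [M M0 fM]]; apply/bounded_operatorP.
split; first exact: is_adjoint_linear fg.
by exists M => //; exact: is_adjoint_bound fg M0 fM.
Qed.

Lemma linear_isometry_bounded H K (f : H -> K) :
  linear_isometry f -> bounded_operator f.
Proof.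
move=> [flin fn]; apply/bounded_operatorP; split=> //.
by exists 1 => // x; rewrite fn mul1r.
Qed.

Lemma bounded_operator_comp H1 H2 H3 (f : H2 -> H3) (g : H1 -> H2) :
  bounded_operator f -> bounded_operator g -> bounded_operator (f \o g).
Proof.
move=> [flin fc] [glin gc]; split; last first.
  by move=> x; apply: continuous_comp; [exact: gc|exact: fc].
by move=> c x y /=; rewrite glin flin.
Qed.

Lemma bounded_operator_scaleD H K (c : C) (f g : H -> K) :
  bounded_operator f -> bounded_operator g ->
  bounded_operator (fun x => c *: f x + g x).
Proof.
move=> /bounded_operatorP[flin [M M0 fM]] /bounded_operatorP[glin [N N0 gN]].
apply/bounded_operatorP; split=> [k x y|].
  by rewrite flin glin !scalerDr !scalerA [c * k]mulrC addrACA.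
exists (`|c| * M + N) => [|x]; first by rewrite addr_ge0// mulr_ge0.
rewrite (le_trans (ler_normD _ _))// mulrDl lerD// normrZ -mulrA.
by rewrite ler_wpM2l.
Qed.

(** The identity [|f (x + t y)| = |x + t y|] for [t] the defect [d] of the inner
    product reads [2 |d|^2 = 0]. *)
Lemma linear_isometry_hdot H K (f : H -> K) x y :
  linear_isometry f -> hdot (f x) (f y) = hdot x y.
Proof.
move=> [flin fn]; apply/eqP; rewrite -subr_eq0; set d := _ - _.
have n z : hdot (f z) (f z) = hdot z z by rewrite -!normr_hdot fn.
have : hdot (f (d *: y + x)) (f (d *: y + x)) = hdot (d *: y + x) (d *: y + x).
  exact: n.
rewrite flin !hdotDl !hdotDr !hdotZl !hdotZr !n => h.
have : 2 * (d * d^* ) = 0.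
  have dc : hdot (f y) (f x) - hdot y x = d^*.
    by rewrite (hdotC (f x)) (hdotC x) -rmorphB.
  transitivity (d * (hdot (f y) (f x) - hdot y x)
                + d^* * (hdot (f x) (f y) - hdot x y)).
    by rewrite dc -/d; ring.
  by move/eqP: h; rewrite -subr_eq0 => /eqP <-; ring.
by move/eqP; rewrite mulf_eq0 pnatr_eq0 /= -normCK sqrf_eq0 normr_eq0.
Qed.

Lemma linear_isometry_adjK H K (f : H -> K) :
  linear_isometry f -> cancel f (adj f).
Proof.
move=> fi x; have fa := bounded_operator_adj (linear_isometry_bounded fi).
by apply: hdot_inj => z; rewrite -fa linear_isometry_hdot.
Qed.

Lemma adj_comp H1 H2 H3 (f : H2 -> H3) (g : H1 -> H2) :
  bounded_operator f -> bounded_operator g -> adj (f \o g) = adj g \o adj f.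
Proof.
move=> /bounded_operator_adj fa /bounded_operator_adj ga.
by apply: adj_unique => x y /=; rewrite fa ga.
Qed.

End Hilbert.

(** * Operators determined by their values on a total family *)

Section TotalFamilies.
Variable R : realType.
Local Notation C := R[i].
Variable X : Type.
Implicit Types (H K : hilbertType R) (s t : seq (C * X)) (c : C).

(** Formal combinations of elements of [X] are lists of pairs, added by
    concatenation. *)
Definition combination H (v : X -> H) s : H := \sum_(u <- s) u.1 *: v u.2.

Definition scale_coefs c s : seq (C * X) := [seq (c * u.1, u.2) | u <- s].

Definition total_family H (v : X -> H) :=
  forall x e, 0 < e -> exists s, `|x - combination v s| <= e.

Lemma combination_cat H (v : X -> H) s t :
  combination v (s ++ t) = combination v s + combination v t.
Proof. exact: big_cat. Qed.

Lemma combination_scale H (v : X -> H) c s :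
  combination v (scale_coefs c s) = c *: combination v s.
Proof.
rewrite /combination big_map scaler_sumr.
by apply: eq_bigr => u _; rewrite scalerA.
Qed.

Lemma combination1 H (v : X -> H) x : combination v [:: (1, x)] = v x.
Proof. by rewrite /combination big_seq1 scale1r. Qed.

Lemma linear_combination H K (F : H -> K) (v : X -> H) s :
  linear F -> F (combination v s) = combination (F \o v) s.
Proof.
move=> Flin; have F0 : F 0 = 0.
  by have := Flin (-1) 0 0; rewrite scaler0 addr0 scaleN1r addNr.
rewrite /combination; elim: s => [|u s IH]; first by rewrite !big_nil.
by rewrite !big_cons Flin IH.
Qed.

Lemma linear_span_range H (v : X -> H) x :
  linear_span (range v) x <-> exists s, x = combination v s.
Proof.
split=> [[n [c [w [wv ->]]]]|[s ->]].
  have /choice[y yE] : forall i, exists x, v x = w i.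
    by move=> i; have [y _ yw] := wv i; exists y.
  exists [seq (c i, y i) | i <- enum 'I_n]; rewrite /combination big_map.
  by rewrite big_enum; apply: eq_bigr => i _; rewrite yE.
exists (size s), (fun i => (tnth (in_tuple s) i).1).
exists (fun i => v (tnth (in_tuple s) i).2); split.
  by move=> i; exists (tnth (in_tuple s) i).2.
by rewrite /combination big_tnth.
Qed.

Lemma closed_span_total H (v : X -> H) :
  closed_span (range v) = setT <-> total_family v.
Proof.
split=> [vT x e e0|vT].
  have : closed_span (range v) x by rewrite vT.
  move=> /(_ (ball x e) (nbhsx_ballx _ _ e0))[y [/linear_span_range[s ->]]].
  by rewrite -ball_normE /= => xs; exists s; exact: ltW.
apply/seteqP; split=> // x _ U; rewrite -nbhs_ballE => -[e /= e0 eU].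
have [s xs] := vT x (e / 2) (divr_gt0 e0 (ltr0Sn _ _)).
exists (combination v s); split; first by apply/linear_span_range; exists s.
apply: eU; rewrite -ball_normE /=; apply: le_lt_trans xs _.
by rewrite ltr_pdivrMr// ltr_pMr// ltr1n.
Qed.

Lemma total_family_operator_eq H K (v : X -> H) (F G : H -> K) :
  total_family v -> bounded_operator F -> bounded_operator G ->
  F \o v = G \o v -> F = G.
Proof.
move=> vT /bounded_operatorP[Flin [M M0 FM]] /bounded_operatorP[Glin [N N0 GN]].
move=> FG; apply/funext => x; apply: (@eq_eps_scale _ _ (M + N)).
  by rewrite addr_ge0.
move=> e e0; have [s xs] := vT x e e0.
have D L : linear L -> forall y z, L (y - z) = L y - L z :> K.
  by move=> Ll y z; rewrite [y - z]addrC -scaleN1r Ll scaleN1r addrC.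
rewrite -(subrKA (F (combination v s))) (le_trans (ler_normD _ _))// mulrDl lerD//.
  by rewrite -D// (le_trans (FM _))// ler_wpM2l.
rewrite linear_combination// FG -linear_combination// -D//.
by rewrite (le_trans (GN _))// distrC ler_wpM2l.
Qed.

Lemma total_family_hdot_inj H (v : X -> H) (y z : H) :
  total_family v -> (forall x, hdot (v x) y = hdot (v x) z) -> y = z.
Proof.
move=> vT h; apply/eqP; rewrite -subr_eq0; apply/eqP.
set w := y - z; have hw x : hdot (v x) w = 0 by rewrite hdotBr h subrr.
apply/eqP; rewrite -normr_eq0; apply/eqP/(@eq_eps_scale _ _ 1) => // e e0.
rewrite subr0 normr_id mul1r; have [s ws] := vT w e e0.
have [->|w0] := eqVneq w 0; first by rewrite normr0 ltW.
rewrite -(@ler_pM2r _ `|w|) ?normr_gt0// -expr2 normr_hdot.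
have sw : hdot (combination v s) w = 0.
  by rewrite hdot_suml big1// => u _; rewrite hdotZl hw mulr0.
rewrite -[leLHS]subr0 -sw -hdotBl -[leLHS]ger0_norm; last first.
  by rewrite hdotBl sw subr0 hdot_ge0.
by rewrite (le_trans (hdot_CauchySchwarz _ _))// ler_wpM2r.
Qed.

(** The value at [x] is the limit of the combinations of the prescribed vectors
    along the combinations of [v1] that approximate [x]. *)
Lemma total_family_extension H K (v1 : X -> H) (v2 : X -> K) (M : C) :
  total_family v1 -> 0 <= M ->
  (forall s, `|combination v2 s| <= M * `|combination v1 s|) ->
  exists2 F : H -> K, bounded_operator F & F \o v1 = v2.
Proof.
move=> v1T M0 v12.
have BE (L : hilbertType R) (v : X -> L) s t :
    combination v (s ++ scale_coefs (-1) t) = combination v s - combination v t.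
  by rewrite combination_cat combination_scale scaleN1r.
pose S x e w := exists2 s, `|x - combination v1 s| <= e & w = combination v2 s.
have lim x : exists y, forall e s, 0 < e -> `|x - combination v1 s| <= e ->
    `|y - combination v2 s| <= M * e.
  have [e e0|e e' v v' _ _ [s xs ->] [t xt ->]|y hy] :=
      @approximations_converge _ K (S x) M M0.
  - by have [s xs] := v1T x e e0; exists (combination v2 s), s.
  - rewrite -BE (le_trans (v12 _))// ler_wpM2l// BE -(subrKA x).
    by rewrite (le_trans (ler_normD _ _))// lerD// distrC.
  - by exists y => e s e0 xs; apply: hy => //; exists s.
have [F hF] := choice lim; have FE s : F (combination v1 s) = combination v2 s.
  by apply: (eq_eps_scale M0) => e e0; apply: hF => //; rewrite subrr normr0 ltW.
exists F; last by apply/funext => x; have := FE [:: (1, x)]; rewrite !combination1.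
apply/bounded_operatorP; split.
  move=> c x y; apply: (@eq_eps_scale _ _ (2 * (M * (`|c| + 1)))).
    by rewrite !mulr_ge0// addr_ge0.
  move=> e e0; have [s xs] := v1T x e e0; have [t yt] := v1T y e e0.
  pose w := c *: combination v2 s + combination v2 t.
  have c0 : 0 < (`|c| + 1) * e by rewrite mulr_gt0// ltr_wpDl.
  rewrite -(subrKA w) (le_trans (ler_normD _ _))// -mulrA mulr_natl mulr2n.
  rewrite -mulrA; apply: lerD.
    rewrite /w -combination_scale -combination_cat hF// combination_cat.
    rewrite combination_scale opprD addrACA -scalerBr.
    by rewrite (le_trans (ler_normD _ _))// normrZ mulrDl mul1r lerD// ler_wpM2l.
  rewrite distrC /w opprD addrACA -scalerBr (le_trans (ler_normD _ _))// normrZ.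
  by rewrite mulrDl mul1r mulrDr lerD ?hF// mulrCA ler_wpM2l// hF.
exists M => // x; apply: (@ler_eps_scale _ (2 * M)); first by rewrite mulr_ge0.
move=> e e0; have [s xs] := v1T x e e0.
rewrite -(subrK (combination v2 s) (F x)) (le_trans (ler_normD _ _))//.
rewrite addrC -mulrA mulr_natl mulr2n addrA lerD ?hF// (le_trans (v12 _))//.
rewrite -mulrDr ler_wpM2l// -[X in `|X|](subrK x) (le_trans (ler_normD _ _))//.
by rewrite addrC lerD2l distrC.
Qed.

(** The isometry and its adjoint are the operators given by
    [total_family_extension] and by the Riesz theorem; comparing them on the
    families shows that they are inverse to each other. *)
Lemma total_family_isometry H K (v1 : X -> H) (v2 : X -> K) :
  total_family v1 ->
  (forall x y, hdot (v2 x) (v2 y) = hdot (v1 x) (v1 y)) ->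
  exists U : H -> K, [/\ linear_isometry U, U \o v1 = v2 &
    total_family v2 -> unitary U].
Proof.
move=> v1T v12.
have [|F Fb Fv] := @total_family_extension _ _ v1 v2 1 v1T ler01.
  move=> s; rewrite mul1r -(@ler_pXn2r _ 2)// ?nnegrE// !normr_hdot.
  rewrite /combination !hdot_suml le_eqVlt; apply/orP; left; apply/eqP.
  apply: eq_bigr => u _; rewrite !hdot_sumr; apply: eq_bigr => w _.
  by rewrite !hdotZl !hdotZr v12.
have Fa := bounded_operator_adj Fb.
have ab := bounded_operator_is_adjoint Fa Fb.
have FvE x : F (v1 x) = v2 x by rewrite -Fv.
have aF : adj F \o F = id.
  apply: (total_family_operator_eq v1T).
  - exact: bounded_operator_comp.
  - by apply: linear_isometry_bounded; split.
  - apply/funext => x; apply: (total_family_hdot_inj v1T) => y /=.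
    by rewrite -Fa !FvE v12.
have Fi : linear_isometry F.
  split=> [|x]; first by case: Fb.
  apply/eqP; rewrite -(@eqrXn2 _ 2)// !normr_hdot Fa.
  by have /= -> := congr1 (@^~ x) aF.
exists F; split=> // v2T; split=> // y; exists (adj F y).
suff : F \o adj F = id by move/(congr1 (@^~ y)).
apply: (total_family_operator_eq v2T).
- exact: bounded_operator_comp.
- by apply: linear_isometry_bounded; split.
- apply/funext => x /=; rewrite -FvE; congr F.
  by rewrite -[LHS]/((adj F \o F) (v1 x)) aF.
Qed.

End TotalFamilies.

(** * The Hilbert space of a positive semidefinite kernel *)

Record psd_kernel (R : realType) (X : Type) := PsdKernel {
  kernel :> X -> X -> R[i] ;
  kernel_psd : forall s : seq (R[i] * X),
    0 <= \sum_(u <- s) \sum_(w <- s) u.1 * w.1^* * kernel u.2 w.2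
}.

Section KernelForm.
Variables (R : realType) (X : Type) (k : psd_kernel R X).
Local Notation C := R[i].
Implicit Types (s t u w : seq (C * X)) (f g : X -> C^o) (c e : C).

(** The antilinear extension of [f] to formal combinations. For a function [f] in
    the Hilbert space of the kernel, this is the inner product of [f] with the
    combination of the sections of the kernel. *)
Definition pairing f s : C := \sum_(u <- s) (u.1)^* * f u.2.

Definition section_of s : X -> C^o := fun y => \sum_(u <- s) u.1 * k u.2 y.

Definition form s t : C := pairing (section_of s) t.

Definition form_norm s : C := sqrtC (form s s).

Lemma pairing_cat f s t : pairing f (s ++ t) = pairing f s + pairing f t.
Proof. exact: big_cat. Qed.

Lemma pairing_scale f c s : pairing f (scale_coefs c s) = c^* * pairing f s.
Proof.
rewrite /pairing big_map mulr_sumr; apply: eq_bigr => u _ /=.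
by rewrite rmorphM mulrA.
Qed.

Lemma pairingP c f g s : pairing (c *: f + g) s = c * pairing f s + pairing g s.
Proof.
rewrite /pairing mulr_sumr -big_split; apply: eq_bigr => u _ /=.
by rewrite mulrDr mulrCA.
Qed.

Lemma pairingD f g s : pairing (f + g) s = pairing f s + pairing g s.
Proof. by rewrite -[f]scale1r pairingP mul1r scale1r. Qed.

Lemma pairingZ c f s : pairing (c *: f) s = c * pairing f s.
Proof.
rewrite /pairing mulr_sumr; apply: eq_bigr => u _ /=.
by rewrite mulrCA.
Qed.

Lemma pairingB f g s : pairing (f - g) s = pairing f s - pairing g s.
Proof.
by rewrite [f - g]addrC -scaleN1r pairingP mulN1r addrC.
Qed.

Lemma pairing1 f x : pairing f [:: (1, x)] = f x.
Proof. by rewrite /pairing big_seq1 rmorph1 mul1r. Qed.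

Lemma section_of_cat s t : section_of (s ++ t) = section_of s + section_of t.
Proof. by apply/funext => y; exact: big_cat. Qed.

Lemma section_of_scale c s : section_of (scale_coefs c s) = c *: section_of s.
Proof.
apply/funext => y; rewrite /section_of big_map.
transitivity (c * \sum_(u <- s) u.1 * k u.2 y) => //.
by rewrite mulr_sumr; apply: eq_bigr => u _; rewrite mulrA.
Qed.

Lemma section_of_sub s t :
  section_of (s ++ scale_coefs (-1) t) = section_of s - section_of t.
Proof. by rewrite section_of_cat section_of_scale scaleN1r. Qed.

Lemma form_ge0 s : 0 <= form s s.
Proof.
have := kernel_psd k s; congr (0 <= _).
rewrite exchange_big /=; apply: eq_bigr => w _.
by rewrite /section_of mulr_sumr; apply: eq_bigr => u _; ring.
Qed.

Lemma form_psd2 s t (a b : C) :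
  0 <= a * a^* * form s s + a * b^* * form s t + b * a^* * form t s
       + b * b^* * form t t.
Proof.
have := form_ge0 (scale_coefs a s ++ scale_coefs b t).
rewrite [X in 0 <= X](_ : _ = a * a^* * form s s + a * b^* * form s t
  + b * a^* * form t s + b * b^* * form t t) //.
rewrite /form section_of_cat !section_of_scale pairing_cat !pairing_scale.
by rewrite !(pairingD, pairingZ); ring.
Qed.

Lemma form_hermitian s t : form t s = (form s t)^*.
Proof. by have [->] := psd2_hermitian_CauchySchwarz (form_psd2 s t). Qed.

Lemma form_norm_ge0 s : 0 <= form_norm s.
Proof. by rewrite sqrtC_ge0 form_ge0. Qed.

Lemma form_CauchySchwarz s t : `|form s t| <= form_norm s * form_norm t.
Proof.
rewrite -(@ler_pXn2r _ 2)// ?nnegrE ?mulr_ge0 ?form_norm_ge0//.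
have [_] := psd2_hermitian_CauchySchwarz (form_psd2 s t).
by rewrite exprMn !sqrtCK.
Qed.

Lemma form_subl s t u : form (s ++ scale_coefs (-1) t) u = form s u - form t u.
Proof. by rewrite /form section_of_sub pairingB. Qed.

(** The operator norm distance of [f] and [section_of u], as functionals, is at
    most [e]. *)
Definition approximates f u e :=
  forall t, `|pairing f t - form u t| <= e * form_norm t.

Lemma approximates_section u : approximates (section_of u) u 0.
Proof. by move=> t; rewrite subrr normr0 mul0r. Qed.

Lemma approximates_sub_section f u e :
  approximates f u e <-> approximates (f - section_of u) [::] e.
Proof.
have E t : form [::] t = 0.
  by rewrite /form /pairing big1// => w _; rewrite /section_of big_nil mulr0.
by split=> fu t; have := fu t; rewrite pairingB E subr0.
Qed.

Lemma approximatesP c f g u w e d : approximates f u e -> approximates g w d ->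
  approximates (c *: f + g) (scale_coefs c u ++ w) (`|c| * e + d).
Proof.
move=> fu gw t; rewrite pairingP /form section_of_cat section_of_scale pairingP.
rewrite opprD addrACA -mulrBr (le_trans (ler_normD _ _))// mulrDl lerD ?gw//.
by rewrite normrM -mulrA ler_wpM2l ?fu.
Qed.

Lemma approximates_le f u e d : e <= d -> approximates f u e -> approximates f u d.
Proof.
by move=> ed fu t; rewrite (le_trans (fu t))// ler_wpM2r ?form_norm_ge0.
Qed.

Lemma form_norm_le u e : 0 <= e ->
  (forall t, `|form u t| <= e * form_norm t) -> form_norm u <= e.
Proof.
move=> e0 /(_ u); have [->//|u0] := eqVneq (form_norm u) 0.
rewrite ger0_norm ?form_ge0// -[form u u]sqrtCK expr2 ler_pM2r//.
by rewrite lt_def u0 form_norm_ge0.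
Qed.

Lemma approximates_close f u w e d : 0 <= e -> 0 <= d ->
  approximates f u e -> approximates f w d ->
  form_norm (u ++ scale_coefs (-1) w) <= e + d.
Proof.
move=> e0 d0 fu fw; apply: form_norm_le => [|t]; first exact: addr_ge0.
rewrite form_subl -(subrKA (pairing f t)) (le_trans (ler_normD _ _))//.
by rewrite mulrDl lerD// distrC.
Qed.

(** The Hilbert space of the kernel is the completion of the span of its sections.
    The completion is made of functions on [X]: those whose antilinear extension is
    approximated in operator norm by sections. Addition, scaling and equality are
    those of functions. *)
Definition in_rkhs : {pred X -> C^o} :=
  [pred f | `[< forall e, 0 < e -> exists u, approximates f u e >]].

Lemma in_rkhsP f :
  reflect (forall e, 0 < e -> exists u, approximates f u e) (f \in in_rkhs).
Proof. exact: asboolP. Qed.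

Lemma in_rkhs_bounded f : f \in in_rkhs ->
  exists2 M, 0 <= M & forall t, `|pairing f t| <= M * form_norm t.
Proof.
move=> /in_rkhsP/(_ 1 ltr01)[u fu]; exists (1 + form_norm u).
  by rewrite addr_ge0 ?form_norm_ge0.
move=> t; rewrite -(subrK (form u t) (pairing f t)) (le_trans (ler_normD _ _))//.
by rewrite mulrDl lerD ?form_CauchySchwarz.
Qed.

Lemma approximates_norm f u e M : 0 <= M -> 0 <= e ->
  (forall t, `|pairing f t| <= M * form_norm t) -> approximates f u e ->
  form_norm u <= M + e.
Proof.
move=> M0 e0 fM fu; apply: form_norm_le => [|t]; first exact: addr_ge0.
rewrite -(subrK (pairing f t) (form u t)) (le_trans (ler_normD _ _))// addrC.
by rewrite mulrDl lerD// distrC.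
Qed.

(** [l] is the inner product of [f] and [g]: the limit of [pairing f u] as the
    section of [u] tends to [g]. *)
Definition is_dot f g (l : C) := exists2 M, 0 <= M &
  forall e u, 0 < e -> approximates g u e -> `|l - pairing f u| <= M * e.

Lemma is_dot_exists f g : f \in in_rkhs -> g \in in_rkhs -> exists l, is_dot f g l.
Proof.
move=> /in_rkhs_bounded[M M0 fM] /in_rkhsP gr.
have [e e0|e e' _ _ e0 e'0 [u gu ->] [w gw ->]|l hl] :=
  @complex_approximations_converge _
    (fun e z => exists2 u, approximates g u e & z = pairing f u) M M0.
- by have [u gu] := gr e e0; exists (pairing f u), u.
- rewrite [X in `|X|](_ : _ = pairing f (u ++ scale_coefs (-1) w)).
    rewrite (le_trans (fM _))// ler_wpM2l//.
    exact: approximates_close (ltW e0) (ltW e'0) gu gw.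
  by rewrite pairing_cat pairing_scale rmorphN rmorph1 mulN1r.
- exists l, (2 * M); first by rewrite mulr_ge0.
  by move=> e u e0 gu; apply: hl => //; exists u.
Qed.

Lemma is_dot_unique f g l l' : g \in in_rkhs ->
  is_dot f g l -> is_dot f g l' -> l = l'.
Proof.
move=> /in_rkhsP gr [M M0 lM] [N N0 l'N].
apply: (@eq_eps_scale _ _ (M + N)) => [|e e0]; first exact: addr_ge0.
have [u gu] := gr e e0.
rewrite -(subrKA (pairing f u)) (le_trans (ler_normD _ _))// mulrDl lerD ?lM//.
by rewrite distrC l'N.
Qed.

Lemma is_dotP c f f' g l l' : is_dot f g l -> is_dot f' g l' ->
  is_dot (c *: f + f') g (c * l + l').
Proof.
move=> [M M0 lM] [N N0 l'N]; exists (`|c| * M + N).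
  by rewrite addr_ge0// mulr_ge0.
move=> e u e0 gu; rewrite pairingP opprD addrACA -mulrBr.
rewrite (le_trans (ler_normD _ _))// mulrDl lerD ?l'N// normrM -mulrA.
by rewrite ler_wpM2l// lM.
Qed.

Lemma is_dot_sym f g l : f \in in_rkhs -> g \in in_rkhs ->
  is_dot f g l -> is_dot g f l^*.
Proof.
move=> /in_rkhs_bounded[N N0 fN] gr [M M0 lM].
have [L L0 gL] := in_rkhs_bounded gr.
exists L => // e u e0 fu.
apply: (@ler_eps_scale _ (M + form_norm u + e)) => [|d d0].
  by rewrite !addr_ge0 ?form_norm_ge0// ltW.
have [w gw] := in_rkhsP _ gr d d0.
have wN : form_norm w <= L + d := approximates_norm L0 (ltW d0) gL gw.
have -> : l^* - pairing g u =
    (l - pairing f w)^* + (pairing f w - form u w)^* - (pairing g u - form w u).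
  by rewrite !rmorphB /= (form_hermitian u w); ring.
rewrite (le_trans (ler_normB _ _))// (le_trans (lerD (ler_normD _ _) (gw u)))//.
rewrite !norm_conjC (le_trans (lerD (lerD (lM _ _ d0 gw) (fu w)) (lexx _)))//.
have ew : e * form_norm w <= e * (L + d) by rewrite ler_wpM2l// ltW.
rewrite (le_trans (lerD (lerD (lexx _) ew) (lexx _)))//.
by rewrite [leLHS](_ : _ = L * e + (M + form_norm u + e) * d) //; ring.
Qed.

Lemma is_dot_section f u : f \in in_rkhs -> is_dot f (section_of u) (pairing f u).
Proof.
move=> /in_rkhs_bounded[M M0 fM]; exists M => // e w e0 uw.
rewrite [X in `|X|](_ : _ = pairing f (u ++ scale_coefs (-1) w)).
  rewrite (le_trans (fM _))// ler_wpM2l//.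
  rewrite -[e]add0r; apply: approximates_close (approximates_section u) uw => //.
  exact: ltW.
by rewrite pairing_cat pairing_scale rmorphN rmorph1 mulN1r.
Qed.

Lemma section_in_rkhs u : section_of u \in in_rkhs.
Proof.
apply/in_rkhsP => e e0; exists u; apply: approximates_le (approximates_section u).
exact: ltW.
Qed.

Lemma is_dot_le f l e : f \in in_rkhs -> 0 <= e -> approximates f [::] e ->
  is_dot f f l -> `|l| <= e ^+ 2.
Proof.
move=> fr e0 f0 [M M0 lM].
apply: (@ler_eps_scale _ (M + e)) => [|d d0]; first exact: addr_ge0.
have [u fu] := in_rkhsP _ fr d d0.
rewrite -[l](subrK (pairing f u)) (le_trans (ler_normD _ _))//.
rewrite [leRHS](_ : _ = M * d + e * (d + e)); last by ring.
rewrite lerD ?lM//; have := approximates_close (ltW d0) e0 fu f0; rewrite cats0 => ud.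
have := f0 u; rewrite /form [pairing (section_of [::]) u]big1.
  by rewrite subr0 => /le_trans; apply; rewrite ler_wpM2l.
by move=> w _; rewrite /section_of big_nil mulr0.
Qed.

Lemma is_dot_ge0 f l : f \in in_rkhs -> is_dot f f l -> 0 <= l.
Proof.
move=> fr [M M0 lM]; have [N N0 fN] := in_rkhs_bounded fr.
suff -> : l = `|l| by [].
apply: (@eq_eps_scale _ _ (2 * (M + (N + 1)))).
  by rewrite mulr_ge0// !addr_ge0.
move=> e e0; pose d := e / (1 + e).
have e1 : 0 < 1 + e by rewrite addr_gt0.
have d0 : 0 < d by rewrite divr_gt0.
have de : d <= e by rewrite ler_pdivrMr// ler_peMr ?lerDl ?ltW.
have d1 : d <= 1 by rewrite ler_pdivrMr// mul1r lerDr.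
have [u fu] := in_rkhsP _ fr d d0.
have lu : `|l - form u u| <= (M + (N + 1)) * e.
  rewrite -(subrKA (pairing f u)) (le_trans (ler_normD _ _))// mulrDl lerD//.
    by rewrite (le_trans (lM _ _ d0 fu))// ler_wpM2l.
  rewrite (le_trans (fu u))// mulrC; apply: ler_pM => //.
  - exact: form_norm_ge0.
  - exact: ltW.
  by rewrite (le_trans (approximates_norm N0 (ltW d0) fN fu))// lerD2l.
rewrite -(subrKA (form u u)) (le_trans (ler_normD _ _))// -mulrA mulr_natl mulr2n.
rewrite lerD// -[X in `|X - _|]ger0_norm ?form_ge0//.
by rewrite (le_trans (ler_dist_dist _ _))// distrC.
Qed.

End KernelForm.

Section ReproducingKernel.
Variables (R : realType) (X : Type) (k : psd_kernel R X).
Local Notation C := R[i].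

Lemma in_rkhs_submod : submod_closed (@in_rkhs R X k).
Proof.
split=> [|c f g /in_rkhsP fr /in_rkhsP gr].
  apply/in_rkhsP => e e0; exists [::] => t.
  rewrite /form /pairing !big1 ?subrr ?normr0 ?mulr_ge0 ?form_norm_ge0 ?ltW//.
    by move=> u _; rewrite /section_of big_nil mulr0.
  by move=> u _; rewrite mulr0.
apply/in_rkhsP => e e0.
have c0 : 0 < `|c| + 1 by rewrite ltr_wpDl.
have [u fu] := fr _ (divr_gt0 e0 c0); have [w gw] := gr _ (divr_gt0 e0 c0).
exists (scale_coefs c u ++ w).
apply: approximates_le (approximatesP c fu gw).
rewrite [leLHS](_ : _ = e) //.
by field; rewrite gt_eqF.
Qed.

HB.instance Definition _ :=
  GRing.isSubmodClosed.Build C (X -> C^o) (@in_rkhs R X k) in_rkhs_submod.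

Record rkhs := Rkhs {
  rkhs_fun : X -> C^o ;
  rkhs_funP : rkhs_fun \in @in_rkhs R X k
}.

HB.instance Definition _ := [isSub for rkhs_fun].
HB.instance Definition _ := [Choice of rkhs by <:].
HB.instance Definition _ := [SubChoice_isSubLmodule of rkhs by <:].

Implicit Types f g h : rkhs.

Definition rkhs_dot f g : C :=
  projT1 (cid (is_dot_exists (rkhs_funP f) (rkhs_funP g))).

Lemma rkhs_dotP f g : is_dot k (rkhs_fun f) (rkhs_fun g) (rkhs_dot f g).
Proof. by rewrite /rkhs_dot; case: cid. Qed.

Lemma rkhs_dotE f g l : is_dot k (rkhs_fun f) (rkhs_fun g) l -> rkhs_dot f g = l.
Proof. exact: is_dot_unique (rkhs_funP g) (rkhs_dotP f g). Qed.

Lemma rkhs_dot_linear g : scalar (rkhs_dot ^~ g).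
Proof. by move=> c f f'; apply: rkhs_dotE; apply: is_dotP; exact: rkhs_dotP. Qed.

Lemma rkhs_dot_conj f g : rkhs_dot f g = (rkhs_dot g f)^*.
Proof.
by apply: rkhs_dotE; apply: is_dot_sym; [exact: rkhs_funP..|exact: rkhs_dotP].
Qed.

Lemma rkhs_dot_bilinear : bilinear_for *%R (Num.conj \; *%R) rkhs_dot.
Proof.
split=> [g c f f'|g c f f'] /=; first exact: rkhs_dot_linear.
rewrite rkhs_dot_conj rkhs_dot_linear rmorphD rmorphM /=.
by rewrite -!rkhs_dot_conj.
Qed.

HB.instance Definition _ := bilinear_isBilinear.Build C rkhs rkhs C
  _ _ rkhs_dot rkhs_dot_bilinear.

Lemma rkhs_dot_hermitian f g :
  rkhs_dot f g = (-1) ^+ false * (rkhs_dot g f)^*.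
Proof. by rewrite expr0 mul1r -rkhs_dot_conj. Qed.

HB.instance Definition _ := isHermitianSesquilinear.Build C rkhs false Num.conj
  rkhs_dot rkhs_dot_hermitian.

Lemma rkhs_dot_ge0 f : 0 <= rkhs_dot f f.
Proof. exact: is_dot_ge0 (rkhs_funP f) (rkhs_dotP f f). Qed.

Definition rkhs_section u : rkhs := Rkhs (section_in_rkhs k u).

Lemma rkhs_dot_section f u : rkhs_dot f (rkhs_section u) = pairing (rkhs_fun f) u.
Proof. by apply: rkhs_dotE; exact: is_dot_section (rkhs_funP f). Qed.

Lemma rkhs_dot_psd2 f g (s t : C) :
  0 <= s * s^* * rkhs_dot f f + s * t^* * rkhs_dot f g
       + t * s^* * rkhs_dot g f + t * t^* * rkhs_dot g g.
Proof.
have [lin_l lin_r] := rkhs_dot_bilinear.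
have := rkhs_dot_ge0 (s *: f + t *: g).
have Z h : rkhs_dot h (t *: g) = t^* * rkhs_dot h g.
  by rewrite -[t *: g]addr0 lin_r /= linear0r addr0.
rewrite lin_l -[t *: g]addr0 lin_l addr0 linear0l addr0 !lin_r /= !Z.
rewrite [X in 0 <= X -> _](_ : _ = s * s^* * rkhs_dot f f + s * t^* * rkhs_dot f g
       + t * s^* * rkhs_dot g f + t * t^* * rkhs_dot g g) //.
by ring.
Qed.

Lemma rkhs_CauchySchwarz f g :
  `|rkhs_dot f g| ^+ 2 <= rkhs_dot f f * rkhs_dot g g.
Proof. by have [_] := psd2_hermitian_CauchySchwarz (rkhs_dot_psd2 f g). Qed.

Lemma rkhs_dot_gt0 f : f != 0 -> 0 < rkhs_dot f f.
Proof.
move=> f0; rewrite lt_def rkhs_dot_ge0 andbT; apply: contra f0 => /eqP ff0.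
apply/eqP/val_inj/funext => x /=.
have := rkhs_CauchySchwarz f (rkhs_section [:: (1, x)]).
rewrite ff0 mul0r rkhs_dot_section pairing1 => fx.
by apply/eqP; rewrite -normr_eq0 -sqrf_eq0 eq_le fx exprn_ge0.
Qed.

HB.instance Definition _ := isDotProduct.Build C rkhs rkhs_dot rkhs_dot_gt0.

Definition rkhs_norm f : C := sqrtC (rkhs_dot f f).

Lemma rkhs_norm_sqr f : rkhs_norm f ^+ 2 = rkhs_dot f f.
Proof. exact: sqrtCK. Qed.

Lemma rkhs_norm_ge0 f : 0 <= rkhs_norm f.
Proof. by rewrite sqrtC_ge0 rkhs_dot_ge0. Qed.

Lemma rkhs_normD f g : rkhs_norm (f + g) <= rkhs_norm f + rkhs_norm g.
Proof.
rewrite -(@ler_pXn2r _ 2)// ?nnegrE ?addr_ge0 ?rkhs_norm_ge0//.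
rewrite rkhs_norm_sqr sqrrD !rkhs_norm_sqr linearDl /= !linearDr /=.
have -> : rkhs_dot f f + rkhs_dot f g + (rkhs_dot g f + rkhs_dot g g) =
    rkhs_dot f f + (rkhs_dot f g + (rkhs_dot f g)^*) + rkhs_dot g g.
  by rewrite (rkhs_dot_conj g f); ring.
rewrite lerD2r lerD2l (le_trans (real_ler_norm _))//.
  by apply/CrealP; rewrite rmorphD /= conjCK addrC.
rewrite (le_trans (ler_normD _ _))// norm_conjC -mulr2n lerMn2r /=.
rewrite -(@ler_pXn2r _ 2)// ?nnegrE ?mulr_ge0 ?rkhs_norm_ge0//.
by rewrite exprMn !rkhs_norm_sqr rkhs_CauchySchwarz.
Qed.

Lemma rkhs_normZ (c : C) f : rkhs_norm (c *: f) = `|c| * rkhs_norm f.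
Proof.
apply/eqP; rewrite -(@eqrXn2 _ 2)// ?mulr_ge0 ?rkhs_norm_ge0// exprMn.
by rewrite !rkhs_norm_sqr linearZl_LR linearZr_LR /= normCK mulrA.
Qed.

Lemma rkhs_norm_eq0 f : rkhs_norm f = 0 -> f = 0.
Proof.
move=> f0; apply/eqP/contraT => /rkhs_dot_gt0.
by rewrite -rkhs_norm_sqr f0 expr0n ltxx.
Qed.

HB.instance Definition _ := Lmodule_isNormed.Build C rkhs
  rkhs_normD rkhs_normZ rkhs_norm_eq0.

Lemma rkhs_norm_le f e : 0 <= e -> approximates k (rkhs_fun f) [::] e -> `|f| <= e.
Proof.
move=> e0 fe; rewrite -(@ler_pXn2r _ 2)// ?nnegrE//.
rewrite -[`|f|]/(rkhs_norm f) rkhs_norm_sqr -[leLHS]ger0_norm ?rkhs_dot_ge0//.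
exact: is_dot_le (rkhs_funP f) e0 fe (rkhs_dotP f f).
Qed.

Lemma rkhs_norm_section u : `|rkhs_section u| = form_norm k u.
Proof.
by rewrite -[LHS]/(rkhs_norm _) /rkhs_norm rkhs_dot_section.
Qed.

Lemma rkhs_section_sub u w :
  rkhs_section (u ++ scale_coefs (-1) w) = rkhs_section u - rkhs_section w.
Proof. by apply/val_inj => /=; rewrite section_of_sub. Qed.

(** The limit of a Cauchy filter is the pointwise limit of the sections of its
    approximations. *)
Lemma rkhs_complete (F : set_system rkhs) : ProperFilter F -> cauchy F -> cvg F.
Proof.
move=> FF /cauchyP Fc; apply/cvg_ex.
pose S e u := exists2 f, F (ball f e) & approximates k (rkhs_fun f) u e.
have S0 e : 0 < e -> exists u, S e u.
  move=> e0; have [f Ff] := Fc e e0.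
  by have [u fu] := in_rkhsP _ _ (rkhs_funP f) e e0; exists u, f.
have Su f u e : 0 < e -> approximates k (rkhs_fun f) u e ->
    `|f - rkhs_section u| <= e.
  by move=> e0 /approximates_sub_section fu; apply: rkhs_norm_le => //; exact: ltW.
have Scauchy e e' u u' : 0 < e -> 0 < e' -> S e u -> S e' u' ->
    `|rkhs_section u - rkhs_section u'| <= 2 * (e + e').
  move=> e0 e'0 [f Ff fu] [f' Ff' fu'].
  have [h [fh f'h]] : ball f e `&` ball f' e' !=set0.
    exact: filter_ex (filterI Ff Ff').
  rewrite -!ball_normE /= in fh f'h.
  have -> : 2 * (e + e') = e + e + e' + e' by ring.
  apply: ler_dist_chain (Su _ _ _ e'0 fu').
  apply: ler_dist_chain (_ : `|h - f'| <= e'); last by rewrite distrC ltW.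
  apply: ler_dist_chain (ltW fh).
  by rewrite distrC; exact: Su.
have form_close e e' u u' t : 0 < e -> 0 < e' -> S e u -> S e' u' ->
    `|form k u t - form k u' t| <= 2 * (e + e') * form_norm k t.
  move=> e0 e'0 Seu Seu'; rewrite -form_subl (le_trans (form_CauchySchwarz _ _ _))//.
  rewrite ler_wpM2r ?form_norm_ge0// -rkhs_norm_section rkhs_section_sub.
  exact: Scauchy.
have lim x : exists l, forall e u, 0 < e -> S e u ->
    `|l - section_of k u x| <= 2 * (2 * form_norm k [:: (1, x)]) * e.
  have [||e e' _ _ e0 e'0 [u Seu ->] [u' Seu' ->]|l hl] :=
    @complex_approximations_converge _
    (fun e z => exists2 u, S e u & z = section_of k u x)
    (2 * form_norm k [:: (1, x)]).
  - by rewrite mulr_ge0 ?form_norm_ge0.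
  - by move=> e e0; have [u Seu] := S0 e e0; exists (section_of k u x), u.
  - rewrite mulrAC -[section_of k u x]pairing1 -[section_of k u' x]pairing1.
    exact: form_close.
  - by exists l => e u e0 Seu; apply: hl => //; exists u.
have [g gl] := choice lim.
have gS e u : 0 < e -> S e u -> approximates k g u (2 * e).
  move=> e0 Seu t.
  have [M M0 hM] : exists2 M, 0 <= M & forall d u', 0 < d -> S d u' ->
      `|pairing g t - form k u' t| <= M * d.
    pose B x := 2 * (2 * form_norm k [:: (1, x)]).
    exists (\sum_(w <- t) `|w.1| * B w.2).
      by apply: sumr_ge0 => w _; rewrite !mulr_ge0 ?form_norm_ge0.
    move=> d u' d0 Sd; rewrite /form -pairingB /pairing.
    rewrite (le_trans (ler_norm_sum _ _ _))// mulr_suml ler_sum// => w _.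
    by rewrite normrM norm_conjC -mulrA ler_wpM2l// gl.
  apply: (@ler_eps_scale _ (M + 2 * form_norm k t)) => [|d d0].
    by rewrite addr_ge0// mulr_ge0 ?form_norm_ge0.
  have [u' Sd] := S0 d d0.
  rewrite -(subrKA (form k u' t)) (le_trans (ler_normD _ _))//.
  rewrite (le_trans (lerD (hM _ _ d0 Sd) (form_close _ _ _ _ t d0 e0 Sd Seu)))//.
  rewrite [leLHS](_ : _ = 2 * e * form_norm k t + (M + 2 * form_norm k t) * d)//.
  by ring.
have gr : g \in @in_rkhs R X k.
  apply/in_rkhsP => e e0; have [u Seu] := S0 (e / 2) (divr_gt0 e0 (ltr0Sn _ _)).
  exists u; apply: approximates_le (gS _ _ _ Seu); last exact: divr_gt0.
  by rewrite mulrCA divff ?mulr1 ?pnatr_eq0.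
pose G := Rkhs gr; exists G.
apply/cvg_ballP => e e0.
pose d := e / 5; have d0 : 0 < d by rewrite divr_gt0.
have [f Ff] := Fc d d0; have [u fu] := in_rkhsP _ _ (rkhs_funP f) d d0.
have Sdu : S d u by exists f.
apply: filterS Ff => h; rewrite -!ball_normE /= => fh.
have gd : `|G - rkhs_section u| <= 2 * d.
  apply: rkhs_norm_le; first by rewrite mulr_ge0// ltW.
  by have /approximates_sub_section := gS _ _ d0 Sdu.
have uf : `|rkhs_section u - f| <= d by rewrite distrC; exact: Su.
apply: le_lt_trans (ler_dist_chain (ler_dist_chain gd uf) (ltW fh)) _.
have -> : 2 * d + d + d = e * (4 / 5) by rewrite /d; field.
by rewrite gtr_pMr// ltr_pdivrMr// mul1r ltr_nat.
Qed.

HB.instance Definition _ := Uniform_isComplete.Build rkhs rkhs_complete.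
HB.instance Definition _ := isHilbert.Build R rkhs rkhs_norm_sqr.

End ReproducingKernel.

(** The theorem of Moore and Aronszajn: the sections of the kernel at the points of
    [X] have the kernel as Gram matrix, and by construction their combinations are
    dense. *)
Lemma kernel_realization (R : realType) (X : Type) (k : psd_kernel R X) :
  exists (K : hilbertType R) (v : X -> K),
    total_family v /\ forall x y, hdot (v x) (v y) = k x y.
Proof.
pose v x : rkhs k := rkhs_section k [:: (1, x)].
have vE u : combination v u = rkhs_section k u.
  elim: u => [|[c x] u IH].
    rewrite /combination big_nil; apply/val_inj/funext => y /=.
    by rewrite /section_of big_nil.
  rewrite /combination big_cons -/(combination v u) IH; apply/val_inj/funext => y /=.
  rewrite /section_of big_cons; congr (_ * _ + _).
  by rewrite big_seq1 mul1r.
exists (rkhs k : hilbertType R), v; split=> [f e e0|x y].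
  have [u fu] := in_rkhsP _ _ (rkhs_funP f) e e0; exists u; rewrite vE.
  apply: rkhs_norm_le; first exact: ltW.
  by move/approximates_sub_section: fu.
rewrite -[LHS]/(rkhs_dot _ _) rkhs_dot_section pairing1 /= /section_of.
by rewrite big_seq1 mul1r.
Qed.

(** * Square roots in a C*-algebra *)

Section CStar.
Variables (R : realType) (A : cstarType R).
Local Notation C := R[i].
Implicit Types (a b x y : A) (c : C).
Local Notation one := (@cstar_one R A).

Lemma cmulDl a b x : (a + b) ** x = a ** x + b ** x.
Proof. exact: linearDl. Qed.

Lemma cmulDr a b x : x ** (a + b) = x ** a + x ** b.
Proof. exact: linearDr. Qed.

Lemma cmulBl a b x : (a - b) ** x = a ** x - b ** x.
Proof. exact: linearBl. Qed.

Lemma cmulBr a b x : x ** (a - b) = x ** a - x ** b.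
Proof. exact: linearBr. Qed.

Lemma cmulZl c a x : (c *: a) ** x = c *: (a ** x).
Proof. exact: linearZl_LR. Qed.

Lemma cmulZr c a x : x ** (c *: a) = c *: (x ** a).
Proof. exact: linearZr_LR. Qed.

Lemma cmul0l x : 0 ** x = 0. Proof. exact: linear0l. Qed.

Lemma cmul0r x : x ** 0 = 0. Proof. exact: linear0r. Qed.

Lemma star0 : star 0 = 0 :> A.
Proof. by apply: (addrI (star 0)); rewrite -starD !addr0. Qed.

Lemma starN a : star (- a) = - star a.
Proof. by apply/eqP; rewrite -addr_eq0 addrC -starD subrr star0. Qed.

Lemma starB a b : star (a - b) = star a - star b.
Proof. by rewrite starD starN. Qed.

Lemma star1 : star one = one.
Proof. by rewrite -[LHS]cmulr1 -[X in _ ** X]starK -starM cmulr1 starK. Qed.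

Lemma normr_star_le a : `|a| <= `|star a|.
Proof.
have [->|a0] := eqVneq a 0; first by rewrite normr0.
rewrite -(@ler_pM2r _ `|a|) ?normr_gt0// -expr2 -normr_star.
exact: normr_cmul.
Qed.

Lemma normr_star_eq a : `|star a| = `|a|.
Proof.
by apply/le_anti; rewrite normr_star_le andbT -{2}(starK a) normr_star_le.
Qed.

Lemma exists_exprn_le (r e : C) : 0 <= r -> r < 1 -> 0 < e ->
  exists n, r ^+ n <= e.
Proof.
case: r e => [r ri] [e ei]; rewrite lecE !ltcE /=.
move=> /andP[/eqP -> r0] /andP[_ r1] /andP[/eqP -> e0].
have : (r ^+ n @[n --> \oo] --> (0 : R))%classic.
  by apply: cvg_expr; rewrite ger0_norm.
move=> /cvgrPdist_lt/(_ e e0)[n _ /(_ n (leqnn n)) /=].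
rewrite sub0r normrN ger0_norm ?exprn_ge0// => rn; exists n.
by rewrite -[Complex r 0]/(r%:C)%C -rmorphXn -[Complex e 0]/(e%:C)%C lecR ltW.
Qed.

(** [one - y] squares to [one - x] when [y] is a fixed point of
    [y |-> (x + y^2) / 2], a contraction of the ball of radius [|x|]. The fixed
    point is unique, hence self-adjoint. *)
Lemma cstar_sqrt x : star x = x -> `|x| < 1 ->
  exists d, star d ** d = one - x.
Proof.
move=> xx x1; set r := `|x|.
have r0 : 0 <= r by exact: normr_ge0.
pose G y := 2^-1 *: (x + y ** y).
have half (z z' : C) : z <= r -> z' <= r -> 2^-1 * (z + z') <= r.
  move=> zr z'r; rewrite mulrC ler_pdivrMr// mulr_natr mulr2n.
  exact: lerD.
have h0 : `|2^-1 : C| = 2^-1 by rewrite ger0_norm.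
have Gr y : `|y| <= r -> `|G y| <= r.
  move=> yr; rewrite /G normrZ h0.
  rewrite (le_trans (ler_wpM2l _ (ler_normD _ _)))//; apply: half => //.
  rewrite (le_trans (normr_cmul _ _))// -[r]mulr1; apply: ler_pM => //.
  exact: le_trans (ltW x1).
have GG y y' : `|y| <= r -> `|y'| <= r -> `|G y - G y'| <= r * `|y - y'|.
  move=> yr y'r; rewrite /G -scalerBr normrZ h0 opprD addrACA subrr add0r.
  have -> : y ** y - y' ** y' = y ** (y - y') + (y - y') ** y'.
    by rewrite cmulBr cmulBl subrKA.
  rewrite (le_trans (ler_wpM2l _ (ler_normD _ _)))//.
  rewrite (le_trans (ler_wpM2l _ (lerD (normr_cmul _ _) (normr_cmul _ _))))//.
  by rewrite [_ * `|y'|]mulrC -mulrDl mulrA ler_wpM2r// half.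
have r1 : 0 < 1 - r :> C by rewrite subr_gt0.
pose S e y := `|y| <= r /\ `|y - G y| <= (1 - r) * e.
have S0 e : 0 < e -> exists y, S e y.
  move=> e0; have [n rn] := exists_exprn_le r0 x1 (mulr_gt0 r1 e0).
  exists (iter n G 0).
  have it m : `|iter m G 0| <= r by elim: m => [|m]; [rewrite normr0|exact: Gr].
  split=> //; apply: le_trans rn; elim: n => [|n IH] /=.
    by rewrite sub0r normrN expr0 (le_trans (Gr _ _)) ?normr0// ltW.
  by rewrite (le_trans (GG _ _ _ _))// ?Gr// exprS ler_wpM2l.
have Scauchy e e' v v' : 0 < e -> 0 < e' -> S e v -> S e' v' ->
    `|v - v'| <= 1 * (e + e').
  move=> _ _ [vr vG] [v'r v'G]; rewrite mul1r -(@ler_pM2l _ (1 - r)) ?r1//.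
  rewrite mulrBl mul1r lerBlDr mulrDr.
  rewrite addrAC; apply: ler_dist_chain (_ : `|G v' - v'| <= _).
    by apply: ler_dist_chain vG _; exact: GG.
  by rewrite distrC.
have [l hl] := approximations_converge ler01 S0 Scauchy.
have lr : `|l| <= r.
  apply: (@ler_eps_scale _ 1) => // e e0; have [v Sv] := S0 e e0.
  rewrite -(subrK v l) (le_trans (ler_normD _ _))// addrC lerD ?hl//.
  by case: Sv.
have lG : l = G l.
  apply: (@eq_eps_scale _ _ 2) => // e e0; have [v Sv] := S0 e e0.
  have lv := hl _ _ e0 Sv; rewrite mul1r in lv; have [vr vG] := Sv.
  have -> : 2 * e = e + (1 - r) * e + r * e by ring.
  apply: ler_dist_chain (ler_dist_chain lv vG) _.
  by rewrite (le_trans (GG _ _ _ _))// ler_wpM2l// distrC.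
have lsG : star l = G (star l).
  by rewrite {1}lG /G starZ starD starM xx fmorphV rmorph_nat.
have ls : star l = l.
  apply/eqP; rewrite -subr_eq0 -normr_eq0; apply/eqP.
  have : (1 - r) * `|star l - l| <= 0.
    have := GG _ _ (_ : `|star l| <= r) lr; rewrite -lsG -lG mulrBl mul1r subr_le0.
    by apply; rewrite normr_star_eq.
  rewrite pmulr_rle0// => h; apply/le_anti.
  by rewrite h normr_ge0.
exists (one - l); rewrite starB star1 ls cmulBl cmul1 cmulBr cmulr1.
have : l + l = x + l ** l.
  by rewrite {1 2}lG /G -scalerDl -[X in X *: _](_ : 1 = _) ?scale1r//; field.
by move=> /esym/(canRL (addrK _)) ->; rewrite -addrA -opprD addrA.
Qed.
End CStar.

(** * The dilation kernel *)

Section System.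
Variables (R : realType) (P : monoidType) (A : cstarType R).
Variable alpha : P -> A -> A.
Hypothesis hsystem : right_LCM_system alpha.
Local Notation C := R[i].
Local Notation one := (@cstar_one R A).
Local Notation e p := (alpha p one).
Implicit Types (p q r s t : P) (a b c : A).

Let action := system_action hsystem.

Lemma alphaM p a b : alpha p (a ** b) = alpha p a ** alpha p b.
Proof. exact: (star_endo_mul (action_endo action p)). Qed.

Lemma alpha_star p a : alpha p (star a) = star (alpha p a).
Proof. exact: (star_endo_star (action_endo action p)). Qed.

Lemma alphaP p (k : C) a b : alpha p (k *: a + b) = k *: alpha p a + alpha p b.
Proof. exact: (star_endo_linear (action_endo action p)). Qed.

Lemma alpha0 p : alpha p 0 = 0.
Proof. by have := alphaP p (-1) 0 0; rewrite !scaleN1r oppr0 addr0 addNr. Qed.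

Lemma alpha_mulg p q a : alpha (p * q)%g a = alpha p (alpha q a).
Proof. by rewrite -(action_comp action). Qed.

Lemma unit_id1 : e 1%g = one.
Proof. by rewrite (action_id action). Qed.

Lemma alpha_unitr p a : alpha p a ** e p = alpha p a.
Proof. by rewrite -alphaM cmulr1. Qed.

Lemma alpha_unitl p a : e p ** alpha p a = alpha p a.
Proof. by rewrite -alphaM cmul1. Qed.

Lemma unit_idem p : e p ** e p = e p. Proof. exact: alpha_unitr. Qed.

Lemma star_unit p : star (e p) = e p.
Proof. by rewrite -alpha_star star1. Qed.

(** Both [e p ** a] and [a ** e p] belong to the ideal, of which [e p] is the unit;
    hence both are equal to [e p ** a ** e p]. *)
Lemma unit_central p a : e p ** a = a ** e p.
Proof.
have ei : range (alpha p) (e p) by exists one.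
have [b _ bE] := ideal_mulr (system_ideal hsystem p) a ei.
have [b' _ b'E] := ideal_mull (system_ideal hsystem p) a ei.
by rewrite -{1}bE -alpha_unitr bE -cmulA -b'E alpha_unitl.
Qed.

Lemma unit_mulgl p q : e (p * q)%g ** e p = e (p * q)%g.
Proof. by rewrite alpha_mulg alpha_unitr. Qed.

Lemma mul_units_multiple p q : e p ** e (p * q)%g = e (p * q)%g.
Proof. by rewrite unit_central unit_mulgl. Qed.

(** The inverse of [alpha p] on its range, extended by zero to the complement
    of this ideal. *)
Definition beta p a : A := get [set b | alpha p b = a ** e p].

Lemma alpha_beta p a : alpha p (beta p a) = a ** e p.
Proof.
apply: (@getPex _ [set b | alpha p b = a ** e p]).
have ei : range (alpha p) (e p) by exists one.
by have [b _ bE] := ideal_mull (system_ideal hsystem p) a ei; exists b.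
Qed.

Lemma beta_eq p a b : alpha p b = a ** e p -> beta p a = b.
Proof. by move=> bE; apply: (action_inj action (p := p)); rewrite alpha_beta bE. Qed.

Lemma beta_alpha p a : beta p (alpha p a) = a.
Proof. by apply: beta_eq; rewrite alpha_unitr. Qed.

Lemma beta_unitr p a : beta p (a ** e p) = beta p a.
Proof. by apply: beta_eq; rewrite alpha_beta -cmulA unit_idem. Qed.

Lemma betaP p (k : C) a b : beta p (k *: a + b) = k *: beta p a + beta p b.
Proof. by apply: beta_eq; rewrite alphaP !alpha_beta cmulDl cmulZl. Qed.

Lemma betaM p a b : beta p (a ** b) = beta p a ** beta p b.
Proof.
apply: beta_eq; rewrite alphaM !alpha_beta.
by rewrite -cmulA [e p ** _]cmulA unit_central -!cmulA unit_idem.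
Qed.

Lemma beta_star p a : beta p (star a) = star (beta p a).
Proof.
by apply: beta_eq; rewrite alpha_star alpha_beta starM star_unit unit_central.
Qed.

Lemma beta_mulg p q a : beta (p * q)%g (alpha p a) = beta q a.
Proof.
by apply: beta_eq; rewrite alpha_mulg alpha_beta alphaM -alpha_mulg.
Qed.

Definition lcm_pair p q p' q' := (p * p' = q * q')%g /\
  principal_right_ideal p `&` principal_right_ideal q
    = principal_right_ideal (p * p')%g.

Lemma lcm_pair_units p q p' q' : lcm_pair p q p' q' ->
  e p ** e q = e (p * p')%g.
Proof. by move=> [_]; exact: (system_lcm hsystem). Qed.

Lemma lcm_pair_divides p q p' q' s t : lcm_pair p q p' q' ->
  (p * s = q * t)%g -> exists r, s = (p' * r)%g /\ t = (q' * r)%g.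
Proof.
move=> [pq pqE] st; have : principal_right_ideal (p * p')%g (p * s)%g.
  by rewrite -pqE; split; [exists s|rewrite st; exists t].
have [_ canc] := system_cancellative hsystem.
move=> [r _ rE]; exists r; split.
  by apply: (canc p); rewrite mulgA rE.
by apply: (canc q); rewrite mulgA -pq rE st.
Qed.

Lemma lcm_cases p q :
  (principal_right_ideal p `&` principal_right_ideal q = set0) \/
  exists p' q', lcm_pair p q p' q'.
Proof.
have [d|[r rE]] := system_right_LCM hsystem p q; [by left|right].
have : principal_right_ideal r r by exists 1%g => //; rewrite mulg1.
rewrite -rE => -[[p' _ pp'] [q' _ qq']]; exists p', q'; split.
  by rewrite pp' qq'.
by rewrite pp'.
Qed.

Section Kernel.
Variables (H : hilbertType R) (phi : A -> H -> H) (T : P -> H -> H).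
Hypothesis hrep : contractive_covariant_rep alpha phi T.
Implicit Types (h g : H).

Let hphi := selfadjoint_map_linear (contractive_covariant_map hrep).
Let hT := contractive_covariant_contractive hrep.

Lemma rep_adjoint p : is_adjoint (T p) (adj (T p)).
Proof. by apply: bounded_operator_adj; case: (hT.2 p). Qed.

Lemma rep_adj_mulg p q h : adj (T (p * q)%g) h = adj (T q) (adj (T p) h).
Proof.
apply: hdot_inj => g.
by rewrite -!rep_adjoint (rep_mul hT.1).
Qed.

Lemma rep_adj1 h : adj (T 1%g) h = h.
Proof. by apply: hdot_inj => g; rewrite -rep_adjoint (rep_one hT.1). Qed.

Lemma rep_adj_linear p (k : C) h g :
  adj (T p) (k *: h + g) = k *: adj (T p) h + adj (T p) g.
Proof. exact: (is_adjoint_linear (rep_adjoint p)). Qed.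

Lemma rep_covariant p a h : phi (alpha p a) h = T p (phi a (adj (T p) h)).
Proof. by rewrite -(contractive_covariant_covariant hrep). Qed.

(** For [c = b^* a], the inner product of [pi(a) V(p) h] and [pi(b) V(q) g] in a
    dilation. The value does not depend on the least common multiple chosen, and is
    [0] when there is none. *)
Definition dilation_form p q c h g : C :=
  xget 0 [set z | exists p' q', lcm_pair p q p' q' /\
    z = hdot (phi (beta (p * p')%g c) (adj (T p') h)) (adj (T q') g)].

Lemma dilation_form_units p q c h g :
  dilation_form p q (c ** e p ** e q) h g = dilation_form p q c h g.
Proof.
congr (xget 0 _); apply/seteqP; split=> z [p' [q' [pq ->]]]; exists p', q';
  by rewrite -cmulA (lcm_pair_units pq) beta_unitr.
Qed.

(** The least common multiple can be replaced with any common multiple [s] such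
    that [c] belongs to the ideal of [s]: this is the covariance of [phi]. *)
Lemma dilation_form_multiple p q s t c h g : (p * s = q * t)%g ->
  c = c ** e (p * s)%g ->
  dilation_form p q c h g
    = hdot (phi (beta (p * s)%g c) (adj (T s) h)) (adj (T t) g).
Proof.
move=> st cE; rewrite /dilation_form; case: xgetP => [z _|no].
  move=> [p' [q' [pq ->]]]; have [r [sE tE]] := lcm_pair_divides pq st.
  rewrite sE tE !rep_adj_mulg; set b := beta (p * (p' * r))%g c.
  have -> : beta (p * p')%g c = alpha r b.
    apply: beta_eq; rewrite -alpha_mulg -mulgA /b alpha_beta -sE -cE.
    by rewrite {2}cE sE mulgA -cmulA unit_mulgl -mulgA -sE -cE.
  by rewrite rep_covariant rep_adjoint.
have [d|[p' [q' pq]]] := lcm_cases p q; last first.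
  by case: (no _ (ex_intro _ p' (ex_intro _ q' (conj pq erefl)))).
have : set0 (p * s)%g by rewrite -d; split; [exists s|rewrite st; exists t].
by [].
Qed.

Lemma dilation_form_disjoint p q c h g :
  principal_right_ideal p `&` principal_right_ideal q = set0 ->
  dilation_form p q c h g = 0.
Proof.
move=> d; rewrite /dilation_form; case: xgetP => // z _ [p' [q' [[pq _] _]]].
have : set0 (p * p')%g by rewrite -d; split; [exists p'|rewrite pq; exists q'].
by [].
Qed.

Lemma dilation_form_lcm p q p' q' c h g : lcm_pair p q p' q' ->
  dilation_form p q c h g
    = hdot (phi (beta (p * p')%g c) (adj (T p') h)) (adj (T q') g).
Proof.
move=> pq; have u : c ** e p ** e q = c ** e (p * p')%g.
  by rewrite -cmulA (lcm_pair_units pq).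
rewrite -dilation_form_units u (dilation_form_multiple _ _ pq.1) ?beta_unitr//.
by rewrite -cmulA unit_idem.
Qed.

Lemma map_linear a (k : C) h g : phi a (k *: h + g) = k *: phi a h + phi a g.
Proof. by have [lin _] := operator_map_bounded hphi a; exact: lin. Qed.

Lemma map_linearl (k : C) a b h : phi (k *: a + b) h = k *: phi a h + phi b h.
Proof. exact: (operator_map_linear hphi). Qed.

Lemma dilation_formP p q (k : C) c c' h g :
  dilation_form p q (k *: c + c') h g
    = k * dilation_form p q c h g + dilation_form p q c' h g.
Proof.
have [d|[p' [q' pq]]] := lcm_cases p q.
  by rewrite !dilation_form_disjoint// mulr0 addr0.
by rewrite !(dilation_form_lcm _ _ _ pq) betaP map_linearl hdotDl hdotZl.
Qed.

Lemma dilation_form_linearl p q c (k : C) h h' g :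
  dilation_form p q c (k *: h + h') g
    = k * dilation_form p q c h g + dilation_form p q c h' g.
Proof.
have [d|[p' [q' pq]]] := lcm_cases p q.
  by rewrite !dilation_form_disjoint// mulr0 addr0.
by rewrite !(dilation_form_lcm _ _ _ pq) rep_adj_linear map_linear hdotDl hdotZl.
Qed.

Lemma dilation_form_linearr p q c (k : C) h g g' :
  dilation_form p q c h (k *: g + g')
    = k^* * dilation_form p q c h g + dilation_form p q c h g'.
Proof.
have [d|[p' [q' pq]]] := lcm_cases p q.
  by rewrite !dilation_form_disjoint// mulr0 addr0.
by rewrite !(dilation_form_lcm _ _ _ pq) rep_adj_linear hdotDr hdotZr.
Qed.

Lemma dilation_form0 p q h g : dilation_form p q 0 h g = 0.
Proof.
have := dilation_formP p q (-1) 0 0 h g.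
by rewrite scaler0 addr0 mulN1r addNr.
Qed.

Lemma dilation_form0l p q c g : dilation_form p q c 0 g = 0.
Proof.
have := dilation_form_linearl p q c (-1) 0 0 g.
by rewrite scaler0 addr0 mulN1r addNr.
Qed.

Lemma dilation_form0r p q c h : dilation_form p q c h 0 = 0.
Proof.
have := dilation_form_linearr p q c (-1) h 0 0.
by rewrite scaler0 addr0 rmorphN rmorph1 mulN1r addNr.
Qed.

Lemma dilation_formZ p q c (k l : C) h g :
  dilation_form p q c (k *: h) (l *: g) = k * l^* * dilation_form p q c h g.
Proof.
rewrite -[k *: h]addr0 dilation_form_linearl dilation_form0l addr0.
by rewrite -[l *: g]addr0 dilation_form_linearr dilation_form0r addr0 mulrA.
Qed.

Lemma dilation_form_unitl p q c h g :
  dilation_form p q (c ** e p) h g = dilation_form p q c h g.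
Proof.
by rewrite -dilation_form_units -[c ** e p ** e p]cmulA unit_idem dilation_form_units.
Qed.

Lemma dilation_form_unitr p q c h g :
  dilation_form p q (c ** e q) h g = dilation_form p q c h g.
Proof.
rewrite -dilation_form_units -[RHS]dilation_form_units; congr dilation_form.
by rewrite -!cmulA (unit_central p) [e q ** (e q ** _)]cmulA unit_idem.
Qed.

Lemma map0 a : phi a 0 = 0.
Proof. by have := map_linear a (-1) 0 0; rewrite !scaleN1r oppr0 addr0 addNr. Qed.

Section Positivity.
Hypothesis hcp : completely_positive phi.

Lemma star_products_positive n (y : 'I_n -> A) (h : 'I_n -> H) :
  0 <= \sum_i \sum_j hdot (phi (star (y j) ** y i) (h i)) (h j).
Proof.
pose X := \matrix_(i < n, j < n) (star (y i) ** y j).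
have Xpos : positive_matrix X.
  (* The matrix with first row [y] and other rows 0. *)
  exists (\matrix_(i < n, j < n) if val i == 0 then y j else 0) => i j.
  have n0 : (0 < n)%N := leq_ltn_trans (leq0n i) (ltn_ord i).
  rewrite (bigD1 (Ordinal n0)) //= big1 ?addr0; first by rewrite !mxE.
  move=> l l0; rewrite !mxE; case: eqP => [l00|_]; last by rewrite cmul0r.
  by case/eqP: l0; exact: val_inj.
have := hcp Xpos h; rewrite /positive_operator_matrix exchange_big /=.
by under eq_bigr do under eq_bigr do rewrite mxE.
Qed.

(** The central projection [E] is refined along the indices in [todo], by
    splitting it as [E e_p + E (1 - e_p)]. Once it is below or orthogonal to
    each [e (p i)], the terms with [E e_p = 0] vanish, the remaining [p i] have a
    common multiple [r] with [E] below [e r], and complete positivity applies. *)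
Lemma dilation_form_positive n (p : 'I_n -> P) (a : 'I_n -> A) (h : 'I_n -> H)
    (todo : seq 'I_n) r (E : A) :
  (forall b, E ** b = b ** E) -> star E = E -> E ** E = E -> E ** e r = E ->
  (forall i, [\/ i \in todo, exists t, r = (p i * t)%g | E ** e (p i) = 0]) ->
  0 <= \sum_i \sum_j
    dilation_form (p i) (p j) (E ** (star (a j) ** a i)) (h i) (h j).
Proof.
elim: todo r E => [|m todo IH] r E Ec Es EE Er Ei.
  (* The indices with [E e_p = 0] do not contribute: their vector is set to 0. *)
  have /choice[y yP] : forall i, exists g : H,
      (exists2 t, r = (p i * t)%g & g = adj (T t) (h i)) \/
      E ** e (p i) = 0 /\ g = 0.
    move=> i; have [//|[t rt]|Ep] := Ei i.
      by exists (adj (T t) (h i)); left; exists t.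
    by exists 0; right.
  have F i j : dilation_form (p i) (p j) (E ** (star (a j) ** a i)) (h i) (h j)
     = hdot (phi (star (beta r (E ** a j)) ** beta r (E ** a i)) (y i)) (y j).
    have -> : star (beta r (E ** a j)) ** beta r (E ** a i)
        = beta r (E ** (star (a j) ** a i)).
      rewrite -beta_star -betaM starM Es; congr beta.
      by rewrite -cmulA [E ** (E ** _)]cmulA EE cmulA -Ec -cmulA.
    have Er' b : E ** b = E ** b ** e r by rewrite Ec -cmulA Er.
    have [[t rt ->]|[Ep ->]] := yP i; last first.
      by rewrite -dilation_form_unitl Ec -cmulA Ep cmul0r dilation_form0 map0 hdot0l.
    have [[t' rt' ->]|[Ep ->]] := yP j; last first.
      by rewrite -dilation_form_unitr Ec -cmulA Ep cmul0r dilation_form0 hdot0r.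
    by rewrite (@dilation_form_multiple _ _ t t') -?rt -?rt'.
  under eq_bigr do under eq_bigr do rewrite F.
  exact: star_products_positive.
pose F := E ** e (p m); pose F' := E - F.
have Fc b : F ** b = b ** F.
  by rewrite /F -cmulA unit_central cmulA Ec cmulA.
have Fs : star F = F by rewrite /F starM Es star_unit unit_central.
have FF : F ** F = F.
  by rewrite {2}/F cmulA [F ** E]Fc [E ** F]cmulA EE -cmulA unit_idem.
have EF : E ** F = F by rewrite /F cmulA EE.
have FEr : F ** e r = F by rewrite /F -cmulA (unit_central (p m)) cmulA Er.
have -> : \sum_i \sum_j
      dilation_form (p i) (p j) (E ** (star (a j) ** a i)) (h i) (h j) =
    \sum_i \sum_j
      dilation_form (p i) (p j) (F ** (star (a j) ** a i)) (h i) (h j) +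
    \sum_i \sum_j
      dilation_form (p i) (p j) (F' ** (star (a j) ** a i)) (h i) (h j).
  rewrite -big_split; apply: eq_bigr => i _; rewrite -big_split.
  apply: eq_bigr => j _ /=.
  by rewrite -[X in X + _]mul1r -dilation_formP scale1r -cmulDl /F' addrC subrK.
have sub0 i : E ** e (p i) = 0 -> F ** e (p i) = 0.
  by move=> E0; rewrite -EF -Fc -cmulA E0 cmul0r.
apply: addr_ge0.
  have [d|[r' [t' rt']]] := lcm_cases r (p m).
    rewrite big1// => i _; rewrite big1// => j _.
    have -> : F = 0.
      by rewrite /F -Er -cmulA (system_disjoint hsystem d) cmul0r.
    by rewrite cmul0l dilation_form0.
  apply: (IH (r * r')%g) => // [|i].
    by rewrite -(lcm_pair_units rt') cmulA FEr /F -cmulA unit_idem.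
  have [] := Ei i; last by move=> /sub0; constructor 3.
    rewrite inE => /orP[/eqP ->|]; last by constructor 1.
    by constructor 2; exists t'; case: rt'.
  by move=> [t ->]; constructor 2; exists (t * r')%g; rewrite mulgA.
apply: (IH r) => // [b||||i].
- by rewrite /F' cmulBl cmulBr Ec Fc.
- by rewrite /F' starB Es Fs.
- by rewrite /F' cmulBr !cmulBl EE FF [F ** E]Fc EF subrr subr0.
- by rewrite /F' cmulBl Er FEr.
- have [] := Ei i; last first.
  + by move=> E0; constructor 3; rewrite /F' cmulBl E0 sub0// subrr.
  + by move=> ?; constructor 2.
  rewrite inE => /orP[/eqP ->|]; last by constructor 1.
  by constructor 3; rewrite /F' cmulBl /F -cmulA unit_idem subrr.
Qed.

End Positivity.

(** * Existence *)

(** [(p, a, h)] stands for the vector [pi(a e_p) V(p) h] of the dilation. *)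
Definition dilation_kernel (x y : P * A * H) : C :=
  dilation_form x.1.1 y.1.1 (star y.1.2 ** x.1.2) x.2 y.2.

Lemma dilation_kernel_psd (s : seq (C * (P * A * H))) :
  completely_positive phi ->
  0 <= \sum_(u <- s) \sum_(w <- s) u.1 * w.1^* * dilation_kernel u.2 w.2.
Proof.
move=> hcp; pose x i := tnth (in_tuple s) i.
have := @dilation_form_positive hcp (size s) (fun i => (x i).2.1.1)
  (fun i => (x i).2.1.2) (fun i => (x i).1 *: (x i).2.2)
  (enum 'I_(size s)) 1%g one.
rewrite unit_id1 cmul1 => pos; have {}pos := pos _ (star1 A) erefl erefl _.
rewrite big_tnth; under eq_bigr do rewrite big_tnth.
rewrite (le_trans (pos _ _))//= => [b|i|].
- by rewrite cmul1 cmulr1.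
- by constructor 1; rewrite mem_enum.
rewrite le_eqVlt; apply/orP; left; apply/eqP.
apply: eq_bigr => i _; apply: eq_bigr => j _.
by rewrite dilation_formZ cmul1.
Qed.

Section Model.
Variables (K : hilbertType R) (v : P * A * H -> K).
Hypothesis vT : total_family v.
Hypothesis vE : forall x y, hdot (v x) (v y) = dilation_kernel x y.

Lemma model_linear p a (k : C) h g :
  v (p, a, k *: h + g) = k *: v (p, a, h) + v (p, a, g).
Proof.
apply: (total_family_hdot_inj vT) => x.
by rewrite hdotDr hdotZr !vE /dilation_kernel dilation_form_linearr.
Qed.

Lemma model_linear_coef p a b (k : C) h :
  v (p, k *: a + b, h) = k *: v (p, a, h) + v (p, b, h).
Proof.
apply: (total_family_hdot_inj vT) => x.
rewrite hdotDr hdotZr !vE /dilation_kernel /= starD starZ cmulDl cmulZl.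
by rewrite dilation_formP.
Qed.

Lemma model0_coef p h : v (p, 0, h) = 0.
Proof.
by have := model_linear_coef p 0 0 (-1) h; rewrite !scaleN1r oppr0 addr0 addNr.
Qed.

(** In a dilation, [a] absorbs [pi(e (p t)) = V(p t) V(p t)^*] on the vector
    [V(p) h], and [V(p t)^* V(p) h = V(t)^* h = T(t)^* h]. In the model, the two
    vectors have the same inner products with all others, because
    [dilation_form_multiple] evaluates both on a multiple of [p t]. *)
Lemma model_shift p t a h : a ** e p = a ** e (p * t)%g ->
  v (p, a, h) = v ((p * t)%g, a, adj (T t) h).
Proof.
move=> aE; apply: (total_family_hdot_inj vT) => -[[q b] g].
rewrite !vE /dilation_kernel /=; set c := star a ** b.
have cE : c ** e p = c ** e (p * t)%g.
  have S r : c ** e r = star (a ** e r) ** b.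
    by rewrite starM star_unit -unit_central /c cmulA.
  by rewrite !S aE.
have cqE : c ** e q ** e p = c ** e q ** e (p * t)%g.
  by rewrite -!cmulA !(unit_central q) !cmulA cE.
rewrite -[LHS]dilation_form_units cqE -cmulA.
have [d|[q' [s qs]]] := lcm_cases q (p * t)%g.
  by rewrite (system_disjoint hsystem d) cmul0r dilation_form0 dilation_form_disjoint.
rewrite (lcm_pair_units qs) (dilation_form_lcm _ _ _ qs).
have qs' : (q * q' = p * (t * s))%g by rewrite mulgA; case: qs.
rewrite (dilation_form_multiple _ _ qs'); last by rewrite -cmulA unit_idem.
by rewrite beta_unitr rep_adj_mulg.
Qed.

Lemma model_unit p a h : v (p, a ** e p, h) = v (p, a, h).
Proof.
apply: (total_family_hdot_inj vT) => -[[q b] g].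
rewrite !vE /dilation_kernel /= starM star_unit unit_central -cmulA.
by rewrite unit_central cmulA dilation_form_unitr.
Qed.

(** For [m > |b|] the operator is bounded by [m]: the difference of
    [m^2 |x|^2] and [|F x|^2] is the quadratic form of [m^2 - b^* b], which is
    positive by [cstar_sqrt]. *)
Lemma model_left_mul_exists b : exists F : K -> K,
  bounded_operator F /\ forall p a h, F (v (p, a, h)) = v (p, b ** a, h).
Proof.
pose L d (x : P * A * H) := v (x.1.1, d ** x.1.2, x.2).
pose Q d (s : seq (C * (P * A * H))) := \sum_(u <- s) \sum_(w <- s) u.1 * w.1^* *
  dilation_form u.2.1.1 w.2.1.1 (star w.2.1.2 ** d ** u.2.1.2) u.2.2 w.2.2.
have QE d (s : seq (C * (P * A * H))) :
    `|combination (L d) s| ^+ 2 = Q (star d ** d) s.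
  rewrite normr_hdot hdot_suml; apply: eq_bigr => u _.
  rewrite hdot_sumr; apply: eq_bigr => w _.
  rewrite hdotZl hdotZr mulrA vE /dilation_kernel /=.
  by rewrite starM !cmulA.
have QP (k : C) d d' (s : seq (C * (P * A * H))) :
    Q (k *: d + d') s = k * Q d s + Q d' s.
  rewrite mulr_sumr -big_split; apply: eq_bigr => u _ /=.
  rewrite mulr_sumr -big_split; apply: eq_bigr => w _ /=.
  by rewrite cmulDr cmulZr cmulDl cmulZl dilation_formP; ring.
pose m := `|b| + 1; have m0 : 0 < m by rewrite ltr_wpDl.
have [||d dE] := @cstar_sqrt _ _ ((m ^+ 2)^-1 *: (star b ** b)).
- rewrite starZ starM starK; congr (_ *: _); apply/CrealP.
  by rewrite ger0_real// invr_ge0 exprn_ge0// ltW.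
- rewrite normrZ normr_star ger0_norm ?invr_ge0 ?exprn_ge0 ?(ltW m0)//.
  rewrite mulrC ltr_pdivrMr ?exprn_gt0// mul1r ltr_pXn2r// ?nnegrE ?(ltW m0)//.
  by rewrite ltrDl.
have [s|F Fb Fv] := @total_family_extension _ _ _ _ v (L b) m vT (ltW m0).
  rewrite -(@ler_pXn2r _ 2)// ?nnegrE ?mulr_ge0 ?(ltW m0)// exprMn QE.
  have -> : combination v s = combination (L one) s.
    by apply: eq_bigr => -[k [[p a] h]] _; rewrite /L /= cmul1.
  rewrite QE star1 cmul1 mulrC -ler_pdivrMr ?exprn_gt0//.
  have : 0 <= Q (star d ** d) s by rewrite -QE exprn_ge0.
  by rewrite dE [one - _]addrC -scaleNr QP mulNr addrC subr_ge0 mulrC.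
by exists F; split=> // p a h; rewrite -[LHS]/((F \o v) _) Fv.
Qed.

Lemma model_translation_exists q : exists F : K -> K,
  linear_isometry F /\ forall p a h, F (v (p, a, h)) = v ((q * p)%g, alpha q a, h).
Proof.
have [x y|F [Fi Fv _]] := @total_family_isometry _ _ _ _ v
  (fun x => v ((q * x.1.1)%g, alpha q x.1.2, x.2)) vT.
  rewrite !vE /dilation_kernel /=.
  case: x y => [[p a] h] [[r b] g] /=; rewrite -alpha_star -alphaM.
  set c := star b ** a; rewrite -[LHS]dilation_form_units -[RHS]dilation_form_units.
  rewrite !alpha_mulg -!alphaM.
  have [d|[p' [r' pr]]] := lcm_cases p r.
    by rewrite -cmulA (system_disjoint hsystem d) cmul0r alpha0 !dilation_form0.
  have {1 2}-> : c ** e p ** e r = c ** e (p * p')%g.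
    by rewrite -cmulA (lcm_pair_units pr).
  rewrite (dilation_form_multiple _ _ pr.1); last by rewrite -cmulA unit_idem.
  have qpr : (q * p * p' = q * r * r')%g by rewrite -!mulgA pr.1.
  rewrite (dilation_form_multiple _ _ qpr); last first.
    by rewrite -mulgA (alpha_mulg q) -alphaM -cmulA unit_idem.
  by rewrite -mulgA beta_mulg.
exists F; split=> // p a h.
by rewrite -[LHS]/((F \o v) _) Fv.
Qed.

Section ModelOperators.
Variables (pi : A -> K -> K) (V : P -> K -> K).
Hypothesis pi_bounded : forall b, bounded_operator (pi b).
Hypothesis pi_v : forall b p a h, pi b (v (p, a, h)) = v (p, b ** a, h).
Hypothesis V_isometry : forall q, linear_isometry (V q).
Hypothesis V_v : forall q p a h, V q (v (p, a, h)) = v ((q * p)%g, alpha q a, h).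

Let V_bounded q : bounded_operator (V q).
Proof. exact: linear_isometry_bounded. Qed.

Let bounded_id : bounded_operator (@id K).
Proof. by apply: linear_isometry_bounded; split. Qed.

Lemma model_operator_eq (F G : K -> K) :
  bounded_operator F -> bounded_operator G ->
  (forall p a h, F (v (p, a, h)) = G (v (p, a, h))) -> F = G.
Proof.
move=> Fb Gb FG; apply: (total_family_operator_eq vT Fb Gb).
by apply/funext => -[[p a] h]; exact: FG.
Qed.

Lemma model_pi_hom : unital_star_hom pi.
Proof.
split; last first.
  move=> a b; apply: model_operator_eq => // [|p c h].
    exact: bounded_operator_comp.
  by rewrite /= !pi_v cmulA.
split.
- split=> // k a b x.
  have := @model_operator_eq (pi (k *: a + b)) (fun x => k *: pi a x + pi b x).
  move=> /(_ (pi_bounded _)) -> //; last first.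
    by move=> p c h; rewrite !pi_v cmulDl cmulZl model_linear_coef.
  exact: bounded_operator_scaleD.
- by apply: model_operator_eq => // p a h; rewrite pi_v cmul1.
- move=> a; have aa := bounded_operator_adj (pi_bounded a).
  apply: model_operator_eq => // [|q b g].
    exact: bounded_operator_is_adjoint aa _.
  apply: (total_family_hdot_inj vT) => -[[p c] h].
  rewrite -aa !pi_v !vE /dilation_kernel /=.
  by rewrite starM starK cmulA.
Qed.

Lemma model_V_rep : isometric_rep V.
Proof.
split=> //; split=> [|p q]; apply: model_operator_eq => //.
- by move=> r a h; rewrite V_v mul1g (action_id action).
- exact: bounded_operator_comp.
- by move=> r a h; rewrite /= !V_v mulgA alpha_mulg.
Qed.

(** [pi(e_q)] maps the vectors of the model into the range of [V(q)], by
    [model_shift], so that [V(q) V(q)^*] fixes its range; and it fixes the range of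
    [V(q)]. Being self-adjoint, the two projections are equal. *)
Lemma model_range_projection q : V q \o adj (V q) = pi (e q).
Proof.
have VV := bounded_operator_adj (V_bounded q).
have Vab := bounded_operator_is_adjoint VV (V_bounded q).
have adjV : cancel (V q) (adj (V q)) by exact: linear_isometry_adjK.
have idem x : V q (adj (V q) (pi (e q) x)) = pi (e q) x.
  suff -> : pi (e q) = V q \o adj (V q) \o pi (e q) by rewrite /= adjV.
  apply: model_operator_eq => // [|p a h].
    by apply: bounded_operator_comp => //; exact: bounded_operator_comp.
  rewrite /= pi_v.
  have [d|[q' [p' qp]]] := lcm_cases q p.
    have -> : v (p, e q ** a, h) = V q 0.
      rewrite -model_unit unit_central -cmulA (system_disjoint hsystem d).
      rewrite cmul0r model0_coef -(model0_coef 1%g 0) V_v alpha0 model0_coef.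
      by rewrite model0_coef.
    by rewrite adjV.
  have -> : v (p, e q ** a, h) = V q (v (q', beta q a, adj (T p') h)).
    rewrite V_v alpha_beta unit_central (@model_shift p p') -?qp.1//.
    by rewrite -!cmulA (lcm_pair_units qp) mul_units_multiple.
  by rewrite adjV.
have fix_range x : pi (e q) (V q x) = V q x.
  suff {2}-> : V q = pi (e q) \o V q by [].
  apply: model_operator_eq => // [|p a h]; first exact: bounded_operator_comp.
  by rewrite /= V_v pi_v alpha_unitl.
have pi_self : is_adjoint (pi (e q)) (pi (e q)).
  rewrite -{2}star_unit (selfadjoint_map_star model_pi_hom.1).
  exact: bounded_operator_adj.
apply/funext => x; apply: hdot_inj => z /=.
rewrite -(pi_self z x) -fix_range -pi_self -(is_adjoint_sym VV) -VV.
by rewrite idem.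
Qed.

Lemma model_covariant : covariant alpha pi V.
Proof.
move=> q a; have Va : V q \o pi a = pi (alpha q a) \o V q.
  apply: model_operator_eq => [||p b h]; try exact: bounded_operator_comp.
  by rewrite /= !(pi_v, V_v) alphaM.
rewrite Va -[LHS]/(pi (alpha q a) \o (V q \o adj (V q))) model_range_projection.
by have [_ <-] := model_pi_hom; rewrite alpha_unitr.
Qed.

Definition model_embedding h : K := v (1%g, one, h).

Lemma model_form1 a h g : dilation_form 1%g 1%g a h g = hdot (phi a h) g.
Proof.
have a1 b : beta (1 * 1)%g b = b.
  by apply: beta_eq; rewrite mulg1 (action_id action) cmulr1.
rewrite (@dilation_form_multiple _ _ 1%g 1%g)// ?a1 ?rep_adj1//.
by rewrite mulg1 unit_id1 cmulr1.
Qed.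

Lemma model_embedding_isometry : linear_isometry model_embedding.
Proof.
split=> [k h g|h]; first exact: model_linear.
apply/eqP; rewrite -(@eqrXn2 _ 2)// !normr_hdot vE /dilation_kernel /=.
rewrite model_form1 star1 cmul1.
by rewrite (selfadjoint_map_one (contractive_covariant_map hrep)).
Qed.

Lemma model_dilation :
  isometric_covariant_dilation alpha phi T model_embedding pi V.
Proof.
have Ja := bounded_operator_adj (linear_isometry_bounded model_embedding_isometry).
split=> [||a|p].
- exact: model_embedding_isometry.
- split; [exact: model_pi_hom|exact: model_V_rep|exact: model_covariant].
- apply/funext => h; apply: hdot_inj => g.
  rewrite hdotC [RHS]hdotC; congr (_^*).
  rewrite /= [RHS]hdotC -Ja -hdotC pi_v vE /dilation_kernel /=.
  by rewrite star1 cmul1 cmulr1 model_form1.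
- apply/funext => h; apply: hdot_inj => g.
  rewrite hdotC [RHS]hdotC; congr (_^*).
  rewrite /= [RHS]hdotC -Ja -hdotC V_v vE /dilation_kernel /= mulg1 star1 cmul1.
  have p1 : (p * 1 = 1 * p)%g by rewrite mul1g mulg1.
  rewrite (dilation_form_multiple _ _ p1) mulg1 ?alpha_unitr// beta_alpha.
  by rewrite (selfadjoint_map_one (contractive_covariant_map hrep)) rep_adj1 rep_adjoint.
Qed.

Lemma model_minimal : minimal_dilation alpha model_embedding pi V.
Proof.
rewrite /minimal_dilation (_ : [set x | _] = range v).
  exact/closed_span_total.
have E p b h : pi (b ** e p) (V p (model_embedding h)) = v (p, b, h).
  by rewrite V_v pi_v mulg1 -cmulA unit_idem model_unit.
apply/seteqP; split=> [x [p [b [h ->]]]|_ [[[p b] h] _ <-]].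
  by exists (p, b, h) => //; rewrite E.
by exists p, b, h; rewrite E.
Qed.

End ModelOperators.

End Model.

Lemma minimal_dilation_exists : completely_positive phi ->
  exists (K : hilbertType R) (J : H -> K) (pi : A -> K -> K) (V : P -> K -> K),
    isometric_covariant_dilation alpha phi T J pi V /\
    minimal_dilation alpha J pi V.
Proof.
move=> hcp.
have [K [v [vT vE]]] := kernel_realization
  (PsdKernel (fun s : seq (C * (P * A * H)) => dilation_kernel_psd s hcp)).
have [pi piP] := choice (model_left_mul_exists vT vE).
have [V VP] := choice (model_translation_exists vT vE).
exists K, (model_embedding v), pi, V; split.
  apply: model_dilation => // [b|b|q|q]; by [case: (piP b)|case: (VP q)].
apply: model_minimal => // [b|q]; by [case: (piP b)|case: (VP q)].
Qed.

(** * Dilations and their uniqueness *)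

Section Dilation.
Variables (K : hilbertType R) (J : H -> K) (pi : A -> K -> K) (V : P -> K -> K).
Hypothesis dil : isometric_covariant_dilation alpha phi T J pi V.

Let pi_hom := isometric_covariant_hom (dilation_rep dil).
Let V_rep := isometric_covariant_isometric (dilation_rep dil).

Let J_bounded := linear_isometry_bounded (dilation_embedding dil).
Let J_adj := bounded_operator_adj J_bounded.

Lemma dilation_pi_bounded a : bounded_operator (pi a).
Proof. exact: operator_map_bounded (selfadjoint_map_linear pi_hom.1) a. Qed.

Lemma dilation_V_bounded p : bounded_operator (V p).
Proof. exact: linear_isometry_bounded (V_rep.2 p). Qed.

Let V_adj p := bounded_operator_adj (dilation_V_bounded p).

Lemma dilation_mapE a h g : hdot (phi a h) g = hdot (pi a (J h)) (J g).
Proof. by rewrite (dilation_map dil) /= (is_adjoint_sym J_adj). Qed.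

Lemma dilation_pi_star a x y : hdot (pi (star a) x) y = hdot x (pi a y).
Proof.
rewrite (selfadjoint_map_star pi_hom.1).
exact: is_adjoint_sym (bounded_operator_adj (dilation_pi_bounded a)) _ _.
Qed.

Lemma dilation_pi0 x : pi 0 x = 0.
Proof.
have := operator_map_linear (selfadjoint_map_linear pi_hom.1) (-1) 0 0 x.
by rewrite scaleN1r oppr0 addr0 scaleN1r addNr.
Qed.

Lemma dilation_pi_sum I (r : seq I) (F : I -> A) x :
  pi (\sum_(i <- r) F i) x = \sum_(i <- r) pi (F i) x.
Proof.
elim: r => [|i r IH]; first by rewrite !big_nil dilation_pi0.
rewrite !big_cons -IH -[F i]scale1r.
by rewrite (operator_map_linear (selfadjoint_map_linear pi_hom.1)) !scale1r.
Qed.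

Lemma dilation_completely_positive : completely_positive phi.
Proof.
move=> n X [Y XE] h.
have -> : \sum_i \sum_j hdot (phi (X i j) (h j)) (h i) =
  \sum_k hdot (\sum_j pi (Y k j) (J (h j))) (\sum_i pi (Y k i) (J (h i))).
  transitivity (\sum_i \sum_j \sum_k
      hdot (pi (Y k j) (J (h j))) (pi (Y k i) (J (h i)))).
    apply: eq_bigr => i _; apply: eq_bigr => j _.
    rewrite dilation_mapE XE dilation_pi_sum hdot_suml.
    by apply: eq_bigr => k _; rewrite pi_hom.2 /= dilation_pi_star.
  under eq_bigr do rewrite exchange_big /=.
  rewrite exchange_big; apply: eq_bigr => k _ /=.
  rewrite exchange_big hdot_suml; apply: eq_bigr => j _ /=.
  by rewrite hdot_sumr.
by apply: sumr_ge0 => k _; exact: hdot_ge0.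
Qed.

Lemma dilation_range_projection p x : V p (adj (V p) x) = pi (e p) x.
Proof.
rewrite -(isometric_covariant_covariant (dilation_rep dil)).
by rewrite (selfadjoint_map_one pi_hom.1).
Qed.

Lemma dilation_intertwine p a x : V p (pi a x) = pi (alpha p a) (V p x).
Proof.
rewrite -(isometric_covariant_covariant (dilation_rep dil)) /=.
by rewrite linear_isometry_adjK//; exact: V_rep.2.
Qed.

Lemma dilation_range_form p h :
  hdot (V p (adj (V p) (J h))) (J h) = hdot (T p (adj (T p) h)) h.
Proof.
rewrite dilation_range_projection -dilation_mapE rep_covariant.
by rewrite (selfadjoint_map_one (contractive_covariant_map hrep)).
Qed.

(** The compression of [V(p)^*] to [H] is [T(p)^*], and it has the norm of
    [V(p)^*] there, since [T(p) T(p)^* = phi(e_p)] is the compression of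
    [V(p) V(p)^* = pi(e_p)]. *)
Lemma dilation_coextension p h : adj (V p) (J h) = J (adj (T p) h).
Proof.
set u := adj (V p) (J h).
have Ju : adj J u = adj (T p) h.
  apply: hdot_inj => g; rewrite -J_adj -rep_adjoint -V_adj.
  by rewrite (dilation_semigroup dil) /= (is_adjoint_sym J_adj).
have Ji := dilation_embedding dil.
have JJ : hdot (adj J u) (adj J u) = hdot u u.
  by rewrite Ju -rep_adjoint -dilation_range_form V_adj.
apply/eqP; rewrite -Ju -subr_eq0 -normr_eq0 -sqrf_eq0 normr_hdot.
rewrite hdotBl !hdotBr linear_isometry_hdot// -(is_adjoint_sym J_adj).
by rewrite J_adj JJ !subrr.
Qed.

Definition dilation_vector (x : P * A * H) : K :=
  pi (x.1.2 ** e x.1.1) (V x.1.1 (J x.2)).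

(** Only the part of [c] under [e p ** e q = e r] counts; it is [alpha r] of
    [beta r c], and [pi (alpha r d) = V(r) pi(d) V(r)^*], where the adjoint of [V(r)]
    cancels [V(p)] and leaves [V(p')^*], which extends [T(p')^*] on [H]. *)
Lemma dilation_gram x y :
  hdot (dilation_vector x) (dilation_vector y) = dilation_kernel x y.
Proof.
case: x y => [[p a] h] [[q b] g]; rewrite /dilation_vector /dilation_kernel /=.
set c := star b ** a.
have cE : star (b ** e q) ** (a ** e p) = c ** (e p ** e q).
  by rewrite starM star_unit -cmulA (unit_central q) -!cmulA.
rewrite -dilation_pi_star.
rewrite -[pi (star _) _]/((pi (star (b ** e q)) \o pi (a ** e p)) _).
rewrite -pi_hom.2 cE.
have [d|[p' [q' pq]]] := lcm_cases p q.
  rewrite (system_disjoint hsystem d) cmul0r dilation_pi0 hdot0l.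
  by rewrite dilation_form_disjoint.
rewrite (lcm_pair_units pq) -alpha_beta (dilation_form_lcm _ _ _ pq).
set r := (p * p')%g.
rewrite -(isometric_covariant_covariant (dilation_rep dil)) /= V_adj.
have coext s t k : adj (V (s * t)%g) (V s (J k)) = J (adj (T t) k).
  rewrite (rep_mul V_rep.1) /=.
  rewrite (adj_comp (dilation_V_bounded s) (dilation_V_bounded t)) /=.
  rewrite linear_isometry_adjK ?dilation_coextension//.
  exact: V_rep.2.
have -> : adj (V r) (V q (J g)) = J (adj (T q') g) by rewrite /r pq.1.
by rewrite coext -dilation_mapE.
Qed.

Lemma dilation_vector_J h : dilation_vector (1%g, one, h) = J h.
Proof.
rewrite /dilation_vector /= cmul1 unit_id1 (selfadjoint_map_one pi_hom.1).
by rewrite (rep_one V_rep.1).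
Qed.

Lemma dilation_vector_pi a p b h :
  pi a (dilation_vector (p, b, h)) = dilation_vector (p, a ** b, h).
Proof. by rewrite /dilation_vector /= -cmulA (pi_hom.2 a). Qed.

Lemma dilation_vector_V q p b h :
  V q (dilation_vector (p, b, h)) = dilation_vector ((q * p)%g, alpha q b, h).
Proof.
rewrite /dilation_vector /= dilation_intertwine alphaM -alpha_mulg.
by rewrite (rep_mul V_rep.1).
Qed.

Lemma dilation_vector_total :
  minimal_dilation alpha J pi V -> total_family dilation_vector.
Proof.
move=> minT; apply/closed_span_total; rewrite -[RHS]minT; congr closed_span.
apply/seteqP; split=> [_ [[[p b] h] _ <-]|x [p [b [h ->]]]].
  by exists p, b, h.
by exists (p, b, h).
Qed.

End Dilation.

Lemma minimal_dilation_unique (K1 K2 : hilbertType R)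
    (J1 : H -> K1) (pi1 : A -> K1 -> K1) (V1 : P -> K1 -> K1)
    (J2 : H -> K2) (pi2 : A -> K2 -> K2) (V2 : P -> K2 -> K2) :
  isometric_covariant_dilation alpha phi T J1 pi1 V1 ->
  minimal_dilation alpha J1 pi1 V1 ->
  isometric_covariant_dilation alpha phi T J2 pi2 V2 ->
  minimal_dilation alpha J2 pi2 V2 ->
  unitarily_equivalent J1 pi1 V1 J2 pi2 V2.
Proof.
move=> dil1 /(dilation_vector_total) T1 dil2 /(dilation_vector_total) T2.
have [x y|U [Ui UE /(_ T2) Uu]] :=
    total_family_isometry (v2 := dilation_vector J2 pi2 V2) T1.
  by rewrite !dilation_gram.
have Uv x : U (dilation_vector J1 pi1 V1 x) = dilation_vector J2 pi2 V2 x.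
  by rewrite -UE.
have Ub := linear_isometry_bounded Ui.
exists U; split=> // [|a|p].
- apply/funext => h /=; rewrite -(dilation_vector_J dil1) Uv.
  exact: dilation_vector_J.
- apply: (total_family_operator_eq T1).
  + by apply: bounded_operator_comp => //; exact: dilation_pi_bounded dil1 a.
  + by apply: bounded_operator_comp => //; exact: dilation_pi_bounded dil2 a.
  + apply/funext => -[[q b] h] /=.
    by rewrite (dilation_vector_pi dil1) !Uv (dilation_vector_pi dil2).
- apply: (total_family_operator_eq T1).
  + by apply: bounded_operator_comp => //; exact: dilation_V_bounded dil1 p.
  + by apply: bounded_operator_comp => //; exact: dilation_V_bounded dil2 p.
  + apply/funext => -[[q b] h] /=.
    by rewrite (dilation_vector_V dil1) !Uv (dilation_vector_V dil2).
Qed.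

End Kernel.
End System.

Theorem theorem5p1 (R : realType) (P : monoidType) (A : cstarType R)
    (alpha : P -> A -> A) (H : hilbertType R)
    (phi : A -> H -> H) (T : P -> H -> H)
    (hsystem : right_LCM_system alpha)
    (hrep : contractive_covariant_rep alpha phi T) :
  ((exists (K : hilbertType R) (J : H -> K) (pi : A -> K -> K)
        (V : P -> K -> K),
      isometric_covariant_dilation alpha phi T J pi V)
    <-> unital_completely_positive phi)
  /\
  ((exists (K : hilbertType R) (J : H -> K) (pi : A -> K -> K)
        (V : P -> K -> K),
      isometric_covariant_dilation alpha phi T J pi V)
    -> exists (K : hilbertType R) (J : H -> K) (pi : A -> K -> K)
        (V : P -> K -> K),
      isometric_covariant_dilation alpha phi T J pi V /\
      minimal_dilation alpha J pi V)
  /\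
  (forall (K1 : hilbertType R) (J1 : H -> K1) (pi1 : A -> K1 -> K1)
       (V1 : P -> K1 -> K1)
       (K2 : hilbertType R) (J2 : H -> K2) (pi2 : A -> K2 -> K2)
       (V2 : P -> K2 -> K2),
     isometric_covariant_dilation alpha phi T J1 pi1 V1 ->
     minimal_dilation alpha J1 pi1 V1 ->
     isometric_covariant_dilation alpha phi T J2 pi2 V2 ->
     minimal_dilation alpha J2 pi2 V2 ->
     unitarily_equivalent J1 pi1 V1 J2 pi2 V2).
Proof.
split; last split.
- split=> [[K [J [pi [V dil]]]]|ucp].
    have map_phi := contractive_covariant_map hrep.
    split; [exact: selfadjoint_map_linear map_phi| |].
      exact: selfadjoint_map_one map_phi.
    exact: dilation_completely_positive dil.
  have [K [J [pi [V [dil _]]]]] :=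
    minimal_dilation_exists hsystem hrep (ucp_positive ucp).
  by exists K, J, pi, V.
- move=> [K [J [pi [V dil]]]].
  exact: minimal_dilation_exists (dilation_completely_positive dil).
- move=> K1 J1 pi1 V1 K2 J2 pi2 V2; exact: minimal_dilation_unique.
Qed.
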